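(* Fix integers $u,m\ge 2$, put $n=u+m$, let $Z$ be uniformly distributed over the $u$-element subsets of $[n]$, and write $\bar Z=[n]\setminus Z$. Let $\mathcal H$ be a nonempty class of real-valued functions on $[n]$. Suppose that, for some $H_0,r>0$, $\sup_{h\in\mathcal H}\max_{i\in[n]}|h(i)|\le H_0$ and $\sup_{h\in\mathcal H}T_n(h)\le r$. Set $\mathfrak R^+_{N_{u,m}}=\mathfrak R^+_u$ when $u\le m$ and $\mathfrak R^+_{N_{u,m}}=\mathfrak R^+_m$ when $m<u$. Set $c_0=\sqrt{219}$. Then, for every $x>0$, with probability at least $1-\exp(-x)$ over $Z$, $$g(\mathcal H,Z)\le \mathbb E[g(\mathcal H,Z)]+c_0\sqrt{\frac{rx}{N_{u,m}}}+\frac{c_0}{2}\,\mathfrak R^+_{N_{u,m}}(\mathcal H^2)+\frac{(16H_0+c_0/2)\,x}{N_{u,m}}.$$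
   Context: $[n]=\{1,\dots,n\}$ and $N_{u,m}=\min\{u,m\}$. For $h:[n]\to\mathbb R$ and nonempty $\mathcal A\subseteq[n]$, $\mathcal L_h(\mathcal A)=|\mathcal A|^{-1}\sum_{i\in\mathcal A}h(i)$; $\mathcal L_n(h)=\mathcal L_h([n])$; $T_n(h)=n^{-1}\sum_{i=1}^n h(i)^2$. The test--train supremum is $g(\mathcal H,Z)=\sup_{h\in\mathcal H}\big(\mathcal L_h(Z)-\mathcal L_h([n]\setminus Z)\big)$. $\mathcal H^2=\{h^2:h\in\mathcal H\}$. For a nonempty class $\mathcal A$ of functions on $[n]$, $\mathfrak R_u^+(\mathcal A)=\mathbb E\big[\sup_{h\in\mathcal A}(\mathcal L_h(Z)-\mathcal L_n(h))\big]$ and $\mathfrak R_m^+(\mathcal A)=\mathbb E\big[\sup_{h\in\mathcal A}(\mathcal L_h(\bar Z)-\mathcal L_n(h))\big]$. All probabilities and expectations are over the random set $Z$. No attainment of suprema is assumed. *)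

(* Defs.v *)
From mathcomp Require Import all_boot all_order all_algebra.
From mathcomp Require Import all_classical all_reals all_analysis.

Set Implicit Arguments.
Unset Strict Implicit.
Unset Printing Implicit Defensive.

Import Order.TTheory GRing.Theory Num.Theory.

Local Open Scope classical_set_scope.
Local Open Scope ring_scope.

(* The index set [n] is the ordinal type 'I_n = {0, ..., n - 1}.  Finite index
   sets are [{set 'I_n}]; classes of functions are classical sets. *)

Definition mean (R : realType) (n : nat) (h : 'I_n -> R) (A : {set 'I_n}) : R :=
  #|A|%:R^-1 * \sum_(i in A) h i.

Definition mean_all (R : realType) (n : nat) (h : 'I_n -> R) : R :=
  mean h [set: 'I_n]%SET.

Definition second_moment (R : realType) (n : nat) (h : 'I_n -> R) : R :=
  n%:R^-1 * \sum_(i < n) h i ^+ 2.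

Definition max_abs (R : realType) (n : nat) (h : 'I_n -> R) : R :=
  \big[Num.max/0]_(i < n) `|h i|.

Definition sqr_class (R : realType) (n : nat) (H : set ('I_n -> R)) :
  set ('I_n -> R) := [set (fun i => h i ^+ 2) | h in H].

(* [sup] is the real supremum, which is 0 on sets that are empty or unbounded
   above; neither occurs for a nonempty class that is uniformly bounded. *)
Definition test_train_sup (R : realType) (n : nat) (H : set ('I_n -> R))
  (Z : {set 'I_n}) : R := sup [set mean h Z - mean h (~: Z)%SET | h in H].

Definition subsets_of_card (n u : nat) : {set {set 'I_n}} :=
  [set Z : {set 'I_n} | #|Z| == u]%SET.

(* Probability and expectation for Z uniform over the u-subsets of [n]. *)
Definition unif_prob (R : realType) (n u : nat) (P : pred {set 'I_n}) : R :=
  #|[set Z in subsets_of_card n u | P Z]%SET|%:R / #|subsets_of_card n u|%:R.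

Definition unif_exp (R : realType) (n u : nat) (X : {set 'I_n} -> R) : R :=
  #|subsets_of_card n u|%:R^-1 * \sum_(Z in subsets_of_card n u) X Z.

(* In both complexities Z is a uniform u-subset of [u + m]; the second one
   averages over the complement of Z, which has m elements. *)
Definition complexity_test (R : realType) (u m : nat)
  (A : set ('I_(u + m) -> R)) : R :=
  unif_exp u (fun Z => sup [set mean h Z - mean_all h | h in A]).

Definition complexity_train (R : realType) (u m : nat)
  (A : set ('I_(u + m) -> R)) : R :=
  unif_exp u (fun Z => sup [set mean h (~: Z)%SET - mean_all h | h in A]).

Definition complexity_min (R : realType) (u m : nat)
  (A : set ('I_(u + m) -> R)) : R :=
  if (u <= m)%N then complexity_test A else complexity_train A.

(* Main.v *)
Require Import Defs.
From mathcomp Require Import all_boot all_order all_algebra.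
From mathcomp Require Import fingroup perm.
From mathcomp Require Import all_classical all_reals all_analysis.
From mathcomp Require Import ring lra zify.

(* The uniform law on a slice {Z : A <= Z <= B, #|Z| = u} satisfies a modified
   logarithmic Sobolev inequality for the exchange walk Z -> Z - i + j, with an
   absolute constant: condition on whether a uniformly random k lies in Z and
   induct on #|B - A|.  Applied to exp(l f) it gives
     Ent(exp(l f)) <= (2 / n) l^2 E[sum_{i, j} (f(Z) - f(Z - i + j))_+^2 exp(l f)].
   For f = g(H, Z) the inner sum is controlled by r + W(Z), where W is the
   supremum, over h in H, of the deviation of h^2 on the smaller of the two sides;
   W in turn controls its own increments.  The entropy method therefore bounds
   the Laplace transform of W, hence, by the Gibbs variational principle and a
   second use of Herbst's argument, that of g.  Chernoff's bound and
   2 sqrt(R x / N) <= R + x / N conclude. *)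

Set Implicit Arguments.
Unset Strict Implicit.
Unset Printing Implicit Defensive.

Import Order.TTheory GRing.Theory Num.Theory.

Local Open Scope ring_scope.

(** * Entropy inequalities *)

Section EntropyInequalities.
Variable R : realType.
Implicit Types a b s t : R.

(** An exchange moves g by a multiple of h(i) - h(j), so the local variance of g at Z depends on the
    means of h^2 on both sides of the split, whereas r only controls the mean over [n]. The larger
    side holds at least half of the points and inherits 2 r; the smaller side may exceed r by as
    much as W. This is how N and the complexity of H^2 enter: the expectation of W joins r in the
    variance, and H0 affects only the term linear in x. Entropy is compared with (a - b)(ln a - ln
    b) because this quantity is homogeneous and jointly convex, hence survives averaging along a
    coupling in the induction, and because on exponentials it is quadratic in the increments.
    Decoupling W from exp(l g) feeds back the multiple 2 a b l^2 of the very entropy being bounded;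
    written as (l B)^2, it can be absorbed as long as l B < 1. *)

Lemma ln_le_subr1 t : 0 < t -> ln t <= t - 1.
Proof.
move=> t0; have -> : t = 1 + (t - 1) by ring.
by rewrite (le_trans (le_ln1Dx _))//; lra.
Qed.

(** The left side is linear in (a, b) and touches the convex right side where a = t b. A slope [t]
    common to all terms gives the log-sum inequality; t = 1 gives the Gibbs principle. *)
Lemma mulr_ln_tangent a b t : 0 < a -> 0 < b -> 0 < t ->
  a * ln t + a - t * b <= a * (ln a - ln b).
Proof.
move=> a0 b0 t0.
have : ln (t * b / a) <= t * b / a - 1.
  by apply: ln_le_subr1; rewrite divr_gt0// mulr_gt0.
rewrite ln_div ?posrE ?mulr_gt0// lnM ?posrE// => h.
have : a * (ln t + ln b - ln a) <= a * (t * b / a - 1) by rewrite ler_wpM2l// ltW.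
have -> : a * (t * b / a - 1) = t * b - a by field; rewrite gt_eqF.
by lra.
Qed.

Lemma log_sum_le (I : finType) (P : pred I) (a b : I -> R) :
  (forall i, P i -> 0 < a i) -> (forall i, P i -> 0 < b i) ->
  (\sum_(i | P i) a i) * (ln (\sum_(i | P i) a i) - ln (\sum_(i | P i) b i)) <=
  \sum_(i | P i) a i * (ln (a i) - ln (b i)).
Proof.
move=> a0 b0; set A := \sum_(i | P i) a i; set B := \sum_(i | P i) b i.
case: (pickP P) => [i0 Pi0|P0]; last first.
  by rewrite /A !big_pred0// mul0r.
have A0 : 0 < A.
  by rewrite /A (bigD1 i0)//= ltr_wpDr ?a0// sumr_ge0// => i /andP[/a0/ltW].
have B0 : 0 < B.
  by rewrite /B (bigD1 i0)//= ltr_wpDr ?b0// sumr_ge0// => i /andP[/b0/ltW].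
have t0 : 0 < A / B by rewrite divr_gt0.
apply: (@le_trans _ _ (\sum_(i | P i) (a i * ln (A / B) + a i - A / B * b i))).
  rewrite sumrB big_split/= -mulr_suml -mulr_sumr -/A -/B divfK ?gt_eqF//.
  by rewrite addrK ln_div ?posrE.
by apply: ler_sum => i Pi; apply: mulr_ln_tangent; [exact: a0|exact: b0|].
Qed.

(** The symmetrized relative entropy of two positive numbers, the integrand of the Dirichlet form of
    F and ln F. As a sum of two relative entropy terms it inherits the log-sum inequality. *)
Definition sym_div a b : R := (a - b) * (ln a - ln b).

Lemma sym_div_sum_le (I : finType) (P : pred I) (a b : I -> R) :
  (forall i, P i -> 0 < a i) -> (forall i, P i -> 0 < b i) ->
  sym_div (\sum_(i | P i) a i) (\sum_(i | P i) b i) <=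
  \sum_(i | P i) sym_div (a i) (b i).
Proof.
move=> a0 b0.
have hab := log_sum_le a0 b0; have hba := log_sum_le b0 a0.
have -> : \sum_(i | P i) sym_div (a i) (b i) =
    \sum_(i | P i) a i * (ln (a i) - ln (b i)) +
    \sum_(i | P i) b i * (ln (b i) - ln (a i)).
  by rewrite -big_split/=; apply: eq_bigr => i _; rewrite /sym_div; ring.
by rewrite /sym_div; lra.
Qed.

Lemma sym_div_ge0 a b : 0 < a -> 0 < b -> 0 <= sym_div a b.
Proof.
move=> a0 b0; rewrite /sym_div; have [ab|ba] := leP a b.
  by rewrite mulr_le0// subr_le0// ler_ln ?posrE.
by rewrite mulr_ge0// subr_ge0 ?ler_ln ?posrE// ltW.
Qed.

Lemma sym_divZ c a b : 0 < c -> 0 < a -> 0 < b ->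
  sym_div (c * a) (c * b) = c * sym_div a b.
Proof. by move=> c0 a0 b0; rewrite /sym_div !lnM ?posrE//; ring. Qed.

(** The right side is the covariance of F and ln F under the unnormalized masses p and q. Replacing
    the mean of ln F in it by the larger ln of the mean lowers it to the entropy. *)
Lemma two_point_entropy_le p q a b : 0 < p -> 0 < q -> 0 < a -> 0 < b ->
  p * a * ln a + q * b * ln b
    - (p * a + q * b) * ln ((p * a + q * b) / (p + q)) <=
  p * q / (p + q) * sym_div a b.
Proof.
move=> p0 q0 a0 b0; have pq0 : 0 < p + q by lra.
set M := (p * a + q * b) / (p + q).
have M0 : 0 < M by rewrite /M divr_gt0// addr_gt0// mulr_gt0.
have ME : (p + q) * M = p * a + q * b by rewrite /M; field; rewrite gt_eqF.
have ha : ln a - ln M <= a / M - 1.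
  by rewrite -ln_div ?posrE//; apply: ln_le_subr1; rewrite divr_gt0.
have hb : ln b - ln M <= b / M - 1.
  by rewrite -ln_div ?posrE//; apply: ln_le_subr1; rewrite divr_gt0.
have hM : p * ln a + q * ln b <= (p + q) * ln M.
  have : p * (ln a - ln M) + q * (ln b - ln M) <=
      p * (a / M - 1) + q * (b / M - 1).
    by rewrite lerD// ler_wpM2l// ltW.
  have -> : p * (a / M - 1) + q * (b / M - 1) = (p * a + q * b - (p + q) * M) / M.
    by field; rewrite gt_eqF.
  by rewrite ME subrr mul0r; lra.
have hM' : M * (p * ln a + q * ln b) <= M * ((p + q) * ln M).
  by rewrite ler_wpM2l// ltW.
have -> : p * q / (p + q) * sym_div a b =
   p * a * ln a + q * b * ln b - M * (p * ln a + q * ln b).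
  by rewrite /sym_div /M; field; rewrite gt_eqF.
by rewrite -ME; lra.
Qed.

End EntropyInequalities.

(** * Modified logarithmic Sobolev inequality on slices *)

Section Slices.
Variables (R : realType) (I : finType).
Implicit Types (A B Z : {set I}) (i j k : I) (F G : {set I} -> R).

(** Taking the image under a transposition makes the exchange a total involution that preserves
    cardinality; it is Z - i + j when i lies in Z and j does not. *)
Definition swap i j Z : {set I} := [set tperm i j x | x in Z]%SET.

Lemma mem_swap i j Z x : (x \in swap i j Z) = (tperm i j x \in Z).
Proof.
apply/imsetP/idP => [[y yZ ->]|xZ]; first by rewrite tpermK.
by exists (tperm i j x) => //; rewrite tpermK.
Qed.

Lemma swapK i j : involutive (swap i j).
Proof. by move=> Z; apply/finset.setP => x; rewrite !mem_swap tpermK. Qed.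

Lemma card_swap i j Z : #|swap i j Z| = #|Z|.
Proof. by rewrite card_imset//; exact: perm_inj. Qed.

(** Both bounds are kept so that fixing whether a point belongs to Z yields a slice again. *)
Definition slice A B (u : nat) : {set {set I}} :=
  [set Z : {set I} | [&& A \subset Z, Z \subset B & #|Z| == u]]%SET.

Lemma swap_slice A B u i j Z : i \in (B :\: A)%SET -> j \in (B :\: A)%SET ->
  (swap i j Z \in slice A B u) = (Z \in slice A B u).
Proof.
suff H Z' : i \in (B :\: A)%SET -> j \in (B :\: A)%SET ->
    Z' \in slice A B u -> swap i j Z' \in slice A B u.
  by move=> iD jD; apply/idP/idP => /H; rewrite ?swapK; apply.
rewrite !inE => /andP[iA iB] /andP[jA jB] /and3P[/fintype.subsetP AZ /fintype.subsetP ZB cZ].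
rewrite card_swap cZ andbT; apply/andP; split; apply/fintype.subsetP => x.
  move=> xA; rewrite mem_swap tpermD ?AZ//.
    by apply: contraNneq iA => ->.
  by apply: contraNneq jA => ->.
by rewrite mem_swap; case: tpermP => [->|->|_ _ /ZB].
Qed.

Lemma slice_in A B u k Z :
  (Z \in slice (k |: A)%SET B u) = (Z \in slice A B u) && (k \in Z).
Proof. by rewrite !inE finset.subUset finset.sub1set -!andbA andbC -!andbA. Qed.

Lemma slice_out A B u k Z :
  (Z \in slice A (B :\ k)%SET u) = (Z \in slice A B u) && (k \notin Z).
Proof. by rewrite !inE subsetD1 -!andbA; do !bool_congr. Qed.

Lemma card_sliceD A B u Z : Z \in slice A B u -> #|(Z :\: A)%SET| = (u - #|A|)%N.
Proof.
by rewrite inE => /and3P[AZ _ /eqP <-]; rewrite cardsD (finset.setIidPr AZ).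
Qed.

Lemma card_slice_compl A B u Z : Z \in slice A B u ->
  #|(B :\: Z)%SET| = (#|B| - u)%N.
Proof.
by rewrite inE => /and3P[_ ZB /eqP <-]; rewrite cardsD (finset.setIidPr ZB).
Qed.

(* Swapping [k] with [j] sends the pairs (Z, j) with [k] in [Z] and [j] outside
   onto the pairs (Z', j) with [j] in [Z'] and [k] outside. *)
Lemma sum_slice_swap A B u k G : k \in (B :\: A)%SET ->
  \sum_(Z in slice (k |: A)%SET B u) \sum_(j in (B :\: Z)%SET) G (swap k j Z) =
  (u - #|A|)%:R * \sum_(Z in slice A (B :\ k)%SET u) G Z.
Proof.
move=> kD; rewrite mulr_sumr.
have -> : \sum_(Z in slice A (B :\ k)%SET u) (u - #|A|)%:R * G Z =
    \sum_(Z in slice A (B :\ k)%SET u) \sum_(j in (Z :\: A)%SET) G Z.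
  apply: eq_bigr => Z; rewrite slice_out => /andP[ZO _].
  by rewrite sumr_const (card_sliceD ZO) mulr_natl.
rewrite (exchange_big_dep (mem (B :\: A)%SET))/=; last first.
  move=> Z j; rewrite slice_in !inE => /andP[/and3P[/fintype.subsetP AZ _ _] _].
  by move=> /andP[jZ ->]; rewrite andbT; apply: contra jZ => /AZ.
rewrite [RHS](exchange_big_dep (mem (B :\: A)%SET))/=; last first.
  move=> Z j; rewrite slice_out !inE => /andP[/and3P[_ /fintype.subsetP ZB _] _].
  by move=> /andP[-> /ZB].
apply: eq_bigr => j jD; rewrite [RHS](reindex_inj (inv_inj (swapK k j)))/=.
apply: eq_bigl => Z; rewrite slice_in slice_out swap_slice//.
move: jD; rewrite !inE !mem_swap tpermL tpermR => /andP[-> ->]/=.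
by rewrite andbT -!andbA; do !bool_congr.
Qed.

(** The entropy under the uniform law on [O], multiplied by the cardinality of [O]: in this scaling
    the entropies of disjoint pieces add. *)
Definition total_ent (T : finType) (O : {set T}) (F : T -> R) : R :=
  \sum_(Z in O) F Z * ln (F Z)
    - (\sum_(Z in O) F Z) * ln ((\sum_(Z in O) F Z) / #|O|%:R).

Lemma total_ent_small (T : finType) (O : {set T}) (F : T -> R) :
  (#|O| <= 1)%N -> total_ent O F = 0.
Proof.
rewrite /total_ent leq_eqVlt => /orP[/cards1P[Z ->]|].
  by rewrite !finset.big_set1 cards1 divr1 subrr.
by rewrite ltnS leqn0 cards_eq0 => /eqP ->; rewrite !finset.big_set0 mul0r subrr.
Qed.

Definition swap_form A B u F : R :=
  \sum_(Z in slice A B u) \sum_(i in (Z :\: A)%SET) \sum_(j in (B :\: Z)%SET)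
    sym_div (F Z) (F (swap i j Z)).

Lemma sum_slice_in A B u k (X : {set I} -> R) :
  \sum_(Z in slice (k |: A)%SET B u) X Z =
  \sum_(Z in slice A B u) (k \in Z)%:R * X Z.
Proof.
under eq_bigl do rewrite slice_in.
by rewrite big_mkcondr; apply: eq_bigr => Z _; case: ifP => _; rewrite ?mul1r ?mul0r.
Qed.

Lemma sum_slice_out A B u k (X : {set I} -> R) :
  \sum_(Z in slice A (B :\ k)%SET u) X Z =
  \sum_(Z in slice A B u) (k \notin Z)%:R * X Z.
Proof.
under eq_bigl do rewrite slice_out.
by rewrite big_mkcondr; apply: eq_bigr => Z _; case: ifP => _; rewrite ?mul1r ?mul0r.
Qed.

Lemma sum_slice_split A B u k (X : {set I} -> R) :
  \sum_(Z in slice A B u) X Z = \sum_(Z in slice (k |: A)%SET B u) X Z +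
    \sum_(Z in slice A (B :\ k)%SET u) X Z.
Proof.
rewrite sum_slice_in sum_slice_out -big_split/=; apply: eq_bigr => Z _.
by case: (k \in Z); rewrite ?mul1r ?mul0r ?addr0 ?add0r.
Qed.

Lemma swap_form_ge0 A B u F : (forall Z, 0 < F Z) -> 0 <= swap_form A B u F.
Proof.
move=> F0; apply: sumr_ge0 => Z _; apply: sumr_ge0 => i _; apply: sumr_ge0 => j _.
exact: sym_div_ge0.
Qed.

(* A pair (i, j) survives the conditioning on [k] unless [k] is [i] or [j]. *)
Lemma sum_swap_form A B u F :
  \sum_(k in (B :\: A)%SET)
     (swap_form (k |: A)%SET B u F + swap_form A (B :\ k)%SET u F) =
  (#|(B :\: A)%SET|%:R - 2) * swap_form A B u F.
Proof.
pose phi Z i j := sym_div (F Z) (F (swap i j Z)).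
have E k : swap_form (k |: A)%SET B u F + swap_form A (B :\ k)%SET u F =
    \sum_(Z in slice A B u) \sum_(i in (Z :\: A)%SET) \sum_(j in (B :\: Z)%SET)
      (1 - (k == i)%:R - (k == j)%:R) * phi Z i j.
  rewrite /swap_form sum_slice_in sum_slice_out -big_split/=.
  apply: eq_bigr => Z _.
  have [kZ|kZ] := boolP (k \in Z); rewrite ?mul1r ?mul0r ?addr0 ?add0r.
    rewrite (eq_bigl (fun i => (i \in (Z :\: A)%SET) && (i != k))); last first.
      by move=> i; rewrite !inE negb_or -!andbA; do !bool_congr.
    rewrite big_mkcondr; apply: eq_bigr => i _.
    case: eqVneq => [->|ik].
      rewrite /= [RHS]big1// => j; rewrite !inE => /andP[jZ _].
      case: eqVneq => [kj|_]; first by rewrite -kj kZ in jZ.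
      by rewrite subrr subr0 mul0r.
    apply: eq_bigr => j; rewrite !inE => /andP[jZ _].
    case: eqVneq => [kj|_]; first by rewrite -kj kZ in jZ.
    by rewrite !subr0 mul1r.
  apply: eq_bigr => i; rewrite !inE => /andP[_ iZ].
  rewrite (eq_bigl (fun j => (j \in (B :\: Z)%SET) && (j != k))); last first.
    by move=> j; rewrite !inE -!andbA; do !bool_congr.
  rewrite big_mkcondr; apply: eq_bigr => j _.
  case: (eqVneq k i) => [ki|_]; first by rewrite -ki (negbTE kZ) in iZ.
  by case: eqVneq => _; rewrite ?subr0 ?subrr ?mul0r ?mul1r.
under eq_bigr do rewrite E.
rewrite exchange_big mulr_sumr; apply: eq_bigr => Z; rewrite inE.
move=> /and3P[/fintype.subsetP AZ /fintype.subsetP ZB _].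
rewrite exchange_big mulr_sumr; apply: eq_bigr => i; rewrite inE => /andP[iA iZ].
rewrite exchange_big mulr_sumr; apply: eq_bigr => j; rewrite inE => /andP[jZ jB].
rewrite -mulr_suml !sumrB sumr_const; congr (_ * _).
have S x : x \in (B :\: A)%SET -> \sum_(k in (B :\: A)%SET) (k == x)%:R = 1 :> R.
  move=> xD; rewrite (bigD1 x)//= eqxx big1 ?addr0// => k /andP[_ kx].
  by rewrite (negbTE kx).
rewrite !S; first by rewrite -addrA -opprD.
  by rewrite inE jB andbT; apply: contra jZ => /AZ.
by rewrite inE iA ZB.
Qed.

End Slices.

Section SliceEntropy.
Variables (R : realType) (I : finType).
Implicit Types (A B Z : {set I}) (i j k : I) (F : {set I} -> R).

(** By the chain rule, the excess over the two conditional entropies is exactly a two-point entropy,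
    with the sizes of the pieces as masses and the conditional means as values. The coupling writes
    both means as averages over the same pairs (Z, j), so that [sym_div_sum_le] applies. *)
Lemma total_ent_slice_split A B u k F : (forall Z, 0 < F Z) ->
  A \subset B -> k \in (B :\: A)%SET -> (#|A| < u < #|B|)%N ->
  (0 < #|slice A B u|)%N ->
  total_ent (slice A B u) F <=
  total_ent (slice (k |: A)%SET B u) F + total_ent (slice A (B :\ k)%SET u) F +
  #|(B :\: A)%SET|%:R^-1 * \sum_(Z in slice (k |: A)%SET B u)
    \sum_(j in (B :\: Z)%SET) sym_div (F Z) (F (swap k j Z)).
Proof.
move=> F0 AB kD /andP[Au uB] O0.
set O := slice A B u; set O1 := slice (k |: A)%SET B u.
set O0' := slice A (B :\ k)%SET u.
(* For each Z in the slice, [v] points of B can enter Z and [w] points outside A can leave it. *)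
pose w : R := (u - #|A|)%:R; pose v : R := (#|B| - u)%:R.
have w0 : 0 < w by rewrite ltr0n subn_gt0.
have v0 : 0 < v by rewrite ltr0n subn_gt0.
have dE : #|(B :\: A)%SET|%:R = v + w.
  rewrite cardsD (finset.setIidPr AB) -natrD; congr _%:R; lia.
have vsum (X : {set I} -> R) : \sum_(Z in O1) \sum_(j in (B :\: Z)%SET) X Z =
    v * \sum_(Z in O1) X Z.
  rewrite mulr_sumr; apply: eq_bigr => Z; rewrite slice_in => /andP[ZO _].
  by rewrite sumr_const (card_slice_compl ZO) mulr_natl.
(* The coupled pairs counted from either end. This turns the two-point factor into v |O1| / (v + w),
   where v + w is the size of B minus A. *)
have NE : v * #|O1|%:R = w * #|O0'|%:R.
  have := sum_slice_swap u (fun _ => 1 : R) kD.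
  by rewrite (vsum (fun=> 1)) !sumr_const.
have ND : #|O|%:R = #|O1|%:R + #|O0'|%:R :> R.
  by have := sum_slice_split A B u k (fun _ => 1 : R); rewrite !sumr_const.
have N0 : 0 < #|O|%:R :> R by rewrite ltr0n.
have N10 : 0 < #|O1|%:R :> R.
  rewrite lt_neqAle ler0n andbT; apply/eqP => N1z.
  move: NE ND; rewrite -N1z mulr0 => /esym/eqP; rewrite mulf_eq0 gt_eqF//= => /eqP ->.
  by rewrite addr0 => Nz; rewrite Nz ltxx in N0.
have N00 : 0 < #|O0'|%:R :> R.
  by rewrite -(pmulr_rgt0 _ w0) -NE mulr_gt0.
have sum_gt0 (T : {set {set I}}) : 0 < #|T|%:R :> R -> 0 < \sum_(Z in T) F Z.
  rewrite ltr0n card_gt0 => /set0Pn[Z ZT].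
  by rewrite (bigD1 Z)//= ltr_wpDr// sumr_ge0// => ? _; exact/ltW.
have S10 := sum_gt0 _ N10; have S00 := sum_gt0 _ N00.
set S1 := \sum_(Z in O1) F Z in S10; set S0 := \sum_(Z in O0') F Z in S00.
pose a := S1 / #|O1|%:R; pose b := S0 / #|O0'|%:R.
have a0 : 0 < a by rewrite divr_gt0.
have b0 : 0 < b by rewrite divr_gt0.
have aE : #|O1|%:R * a = S1 by rewrite /a mulrC divfK ?gt_eqF.
have bE : #|O0'|%:R * b = S0 by rewrite /b mulrC divfK ?gt_eqF.
have div_le : v * #|O1|%:R * sym_div a b <=
    \sum_(Z in O1) \sum_(j in (B :\: Z)%SET) sym_div (F Z) (F (swap k j Z)).
  rewrite -sym_divZ//; last exact: mulr_gt0.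
  have -> : v * #|O1|%:R * a = \sum_(Z in O1) \sum_(j in (B :\: Z)%SET) F Z.
    by rewrite vsum -mulrA aE.
  have -> : v * #|O1|%:R * b =
      \sum_(Z in O1) \sum_(j in (B :\: Z)%SET) F (swap k j Z).
    by rewrite NE -mulrA bE sum_slice_swap.
  by rewrite !pair_big_dep/=; apply: sym_div_sum_le.
have := two_point_entropy_le N10 N00 a0 b0.
rewrite aE bE => tp.
have -> : total_ent O F = total_ent O1 F + total_ent O0' F +
    (S1 * ln a + S0 * ln b - (S1 + S0) * ln ((S1 + S0) / (#|O1|%:R + #|O0'|%:R))).
  rewrite /total_ent !(sum_slice_split A B u k) -/O1 -/O0' -/S1 -/S0 ND -/a -/b.
  by ring.
rewrite lerD2l (le_trans tp)//.
have -> : #|O1|%:R * #|O0'|%:R / (#|O1|%:R + #|O0'|%:R) * sym_div a b =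
    #|(B :\: A)%SET|%:R^-1 * (v * #|O1|%:R * sym_div a b).
  have e : #|O0'|%:R * (v + w) = v * (#|O1|%:R + #|O0'|%:R) :> R.
    by rewrite mulrDr mulrDr NE; ring.
  have e' : #|O0'|%:R / (#|O1|%:R + #|O0'|%:R) = (v + w)^-1 * v :> R.
    apply: (@mulIf _ (#|O1|%:R + #|O0'|%:R)); first by rewrite gt_eqF// addr_gt0.
    rewrite divfK; last by rewrite gt_eqF// addr_gt0.
    by rewrite -mulrA -e; field; rewrite gt_eqF// addr_gt0.
  rewrite dE; transitivity (#|O1|%:R * (#|O0'|%:R / (#|O1|%:R + #|O0'|%:R)) * sym_div a b).
    by rewrite !mulrA.
  by rewrite e'; ring.
by rewrite ler_wpM2l// invr_ge0.
Qed.

Lemma card_slice_le1 A B u : ~~ (#|A| < u < #|B|)%N -> (#|slice A B u| <= 1)%N.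
Proof.
have le1 (T : {set {set I}}) Y : {in T, forall Z, Z = Y} -> (#|T| <= 1)%N.
  move=> TY; rewrite -(cards1 Y); apply/subset_leq_card/fintype.subsetP => Z ZT.
  by rewrite inE (TY _ ZT).
rewrite negb_and -!leqNgt => /orP[uA|Bu].
  apply: (@le1 _ A) => Z; rewrite inE => /and3P[AZ _ /eqP cZ].
  by apply/eqP; rewrite eq_sym eqEcard AZ cZ.
apply: (@le1 _ B) => Z; rewrite inE => /and3P[_ ZB /eqP cZ].
by apply/eqP; rewrite eqEcard ZB cZ.
Qed.

(* Conditioning on the membership of a uniformly random [k] splits the entropy
   into the two conditional entropies, bounded inductively, and a two-point
   entropy, bounded through the coupling Z -> swap k j Z. *)
Theorem slice_log_sobolev A B u F : (forall Z, 0 < F Z) -> A \subset B ->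
  #|(B :\: A)%SET|%:R * total_ent (slice A B u) F <= swap_form A B u F.
Proof.
move=> F0; move: {2}#|_| (erefl #|(B :\: A)%SET|) => d.
elim: d A B => [|d IH] A B dE AB.
  by rewrite dE mul0r swap_form_ge0.
have [small|big] := leqP #|slice A B u| 1.
  by rewrite total_ent_small// mulr0 swap_form_ge0.
have AuB : (#|A| < u < #|B|)%N.
  by apply: contraLR big => /card_slice_le1; rewrite -leqNgt.
(* The strict bounds on u leave at least two free points, so d >= 1 and d can be cancelled at the
   end. *)
have d0 : 0 < d%:R :> R.
  rewrite ltr0n; have := cardsD B A; rewrite (finset.setIidPr AB); lia.
rewrite dE; set DD := swap_form A B u F.
have IH1 k : k \in (B :\: A)%SET -> d%:R * total_ent (slice (k |: A)%SET B u) F <=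
    swap_form (k |: A)%SET B u F.
  move=> kD; have e : #|(B :\: (k |: A))%SET| = d.
    move: dE; rewrite (cardsD1 k) kD add1n => -[<-]; congr #|pred_of_set _|.
    by apply/finset.setP => x; rewrite !inE negb_or -!andbA.
  rewrite -{1}e; apply: IH => //.
  by rewrite finset.subUset finset.sub1set AB andbT; move: kD; rewrite inE => /andP[].
have IH0 k : k \in (B :\: A)%SET -> d%:R * total_ent (slice A (B :\ k)%SET u) F <=
    swap_form A (B :\ k)%SET u F.
  move=> kD; have e : #|(B :\ k :\: A)%SET| = d.
    move: dE; rewrite (cardsD1 k) kD add1n => -[<-]; congr #|pred_of_set _|.
    by apply/finset.setP => x; rewrite !inE; do !bool_congr.
  rewrite -{1}e; apply: IH => //.
  by rewrite subsetD1 AB; move: kD; rewrite inE => /andP[].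
(* With k as the point that leaves Z, the coupling terms run through every exchange once. *)
have cpl : \sum_(k in (B :\: A)%SET) \sum_(Z in slice (k |: A)%SET B u)
    \sum_(j in (B :\: Z)%SET) sym_div (F Z) (F (swap k j Z)) = DD.
  rewrite (exchange_big_dep (mem (slice A B u)))/=; last first.
    by move=> k Z _; rewrite slice_in => /andP[].
  apply: eq_bigr => Z ZO; apply: eq_bigl => k; rewrite slice_in ZO/= !inE.
  move: ZO; rewrite inE => /and3P[_ /fintype.subsetP ZB _].
  by case: (boolP (k \in Z)) => [/ZB ->|]; rewrite ?andbT ?andbF.
have : \sum_(k in (B :\: A)%SET) d%:R * total_ent (slice A B u) F <=
    \sum_(k in (B :\: A)%SET) (swap_form (k |: A)%SET B u F +
      swap_form A (B :\ k)%SET u F + d%:R * (d.+1%:R^-1 *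
        \sum_(Z in slice (k |: A)%SET B u) \sum_(j in (B :\: Z)%SET)
          sym_div (F Z) (F (swap k j Z)))).
  apply: ler_sum => k kD.
  have := total_ent_slice_split F0 AB kD AuB (ltnW big).
  rewrite dE => hk; apply: (le_trans (ler_wpM2l (ltW d0) hk)); rewrite mulrDr lerD2r.
  by rewrite mulrDr; apply: lerD; [exact: IH1|exact: IH0].
rewrite sumr_const dE big_split/= sum_swap_form -!mulr_sumr cpl dE -/DD => h.
have DD0 : 0 <= DD by exact: swap_form_ge0.
have d1 : d%:R * (d.+1%:R^-1 * DD) <= DD.
  by rewrite mulrA ler_piMl// ler_pdivrMr ?ltr0n// mul1r ler_nat.
(* The conditional forms contribute (d - 1) [DD] and the coupling terms at most [DD]: together d
   [DD], against d (d + 1) times the entropy. *)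
rewrite -(ler_pM2l d0) mulrCA mulr_natl.
have e : (d.+1%:R - 2) * DD = d%:R * DD - DD by rewrite -[d.+1%:R]natr1; ring.
by apply: (le_trans h); rewrite e -addrA gerDl addrC subr_le0.
Qed.

End SliceEntropy.

(** * Herbst's argument and concentration with a random variance proxy *)

Section Averages.
Variables (R : realType) (T : finType) (O : {set T}).
Hypothesis O_neq0 : (0 < #|O|)%N.
Implicit Types (X Y G : T -> R).

Definition avg X : R := #|O|%:R^-1 * \sum_(z in O) X z.

Lemma avgD X Y : avg (fun z => X z + Y z) = avg X + avg Y.
Proof. by rewrite /avg big_split/= mulrDr. Qed.

Lemma avgZ c X : avg (fun z => c * X z) = c * avg X.
Proof. by rewrite /avg -mulr_sumr mulrCA. Qed.

Lemma avg_cst c : avg (fun _ => c) = c.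
Proof.
by rewrite /avg sumr_const -[c *+ _]mulr_natl mulKf// pnatr_eq0 -lt0n.
Qed.

Lemma eq_avg X Y : (forall z, z \in O -> X z = Y z) -> avg X = avg Y.
Proof. by move=> XY; rewrite /avg (eq_bigr Y). Qed.

Lemma ler_avg X Y : (forall z, z \in O -> X z <= Y z) -> avg X <= avg Y.
Proof. by move=> XY; rewrite ler_wpM2l ?invr_ge0// ler_sum. Qed.

Lemma avg_gt0 X : (forall z, 0 < X z) -> 0 < avg X.
Proof.
move=> X0; rewrite mulr_gt0 ?invr_gt0 ?ltr0n//.
move: (O_neq0) => /card_gt0P[z zO].
by rewrite (bigD1 z)//= ltr_wpDr// sumr_ge0// => ? _; exact/ltW.
Qed.

Lemma total_ent_avg G : total_ent O G =
  #|O|%:R * (avg (fun z => G z * ln (G z)) - avg G * ln (avg G)).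
Proof.
have Nn0 : #|O|%:R != 0 :> R by rewrite pnatr_eq0 -lt0n.
rewrite /total_ent /avg mulrBr !mulrA divff// !mul1r.
by rewrite [(\sum_(z in O) G z) / _]mulrC.
Qed.

(* Gibbs variational principle, from xy <= x ln x - x + e^y applied pointwise. *)
Lemma avg_mul_le_entropy G X : (forall z, 0 < G z) ->
  avg (fun z => G z * X z) <=
  avg (fun z => G z * ln (G z)) - avg G * ln (avg G)
    + avg G * ln (avg (fun z => expR (X z))).
Proof.
move=> G0; set E := avg (fun z => expR (X z)).
have AG0 : 0 < avg G by exact: avg_gt0.
have E0 : 0 < E by apply: avg_gt0 => z; exact: expR_gt0.
pose y z := X z + ln (avg G / E).
have : avg (fun z => G z * y z + G z) <=
       avg (fun z => G z * ln (G z) + expR (y z)).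
  apply: ler_avg => z _.
  have := mulr_ln_tangent (G0 z) (expR_gt0 (y z)) ltr01.
  by rewrite ln1 expRK; lra.
rewrite !avgD.
have -> : avg (fun z => expR (y z)) = avg G.
  rewrite (@eq_avg _ (fun z => avg G / E * expR (X z))).
    by rewrite avgZ -/E divfK// gt_eqF.
  by move=> z _; rewrite /y expRD lnK ?posrE ?divr_gt0// mulrC.
have -> : avg (fun z => G z * y z) =
    avg (fun z => G z * X z) + ln (avg G / E) * avg G.
  by rewrite -avgZ -avgD; apply: eq_avg => z _; rewrite /y mulrDr [G z * ln _]mulrC.
by rewrite ln_div ?posrE//; lra.
Qed.

Lemma entropy_ge0 G : (forall z, 0 < G z) ->
  0 <= avg (fun z => G z * ln (G z)) - avg G * ln (avg G).
Proof.
move=> /avg_mul_le_entropy - /(_ (fun _ => 0)).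
rewrite expR0 avg_cst ln1 mulr0 addr0 (@eq_avg _ (fun => 0)) ?avg_cst//.
by move=> z _; rewrite mulr0.
Qed.

Definition mgf Y (l : R) : R := avg (fun z => expR (l * Y z)).

Lemma mgf_gt0 Y l : 0 < mgf Y l.
Proof. by apply: avg_gt0 => z; exact: expR_gt0. Qed.

Lemma mgf_ge1 Y l : avg Y = 0 -> 1 <= mgf Y l.
Proof.
move=> Y0; rewrite -[X in X <= _](_ : avg (fun z => 1 + l * Y z) = 1).
  by apply: ler_avg => z _; exact: expR_ge1Dx.
by rewrite avgD avg_cst avgZ Y0 mulr0 addr0.
Qed.

Lemma is_derive_bigsum (s : seq T) (P : pred T) (f : T -> R -> R) (df : T -> R) (x : R) :
  (forall z, is_derive x (1 : R) (f z) (df z)) ->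
  is_derive x (1 : R) (fun l => \sum_(z <- s | P z) f z l) (\sum_(z <- s | P z) df z).
Proof.
move=> fd; elim: s => [|z s IH].
  rewrite big_nil (_ : (fun _ => _) = cst 0); first exact: is_derive_cst.
  by apply/funext => l; rewrite big_nil.
rewrite big_cons; case: (boolP (P z)) => Pz.
  rewrite (_ : (fun _ => _) = f z + (fun l => \sum_(z <- s | P z) f z l)).
    exact: is_deriveD.
  by apply/funext => l; rewrite big_cons Pz.
rewrite (_ : (fun _ => _) = (fun l => \sum_(z <- s | P z) f z l))//.
by apply/funext => l; rewrite big_cons (negbTE Pz).
Qed.

Lemma is_derive_mgf Y (x : R) :
  is_derive x (1 : R) (mgf Y) (avg (fun z => Y z * expR (x * Y z))).
Proof.
have d z : is_derive x (1 : R) (fun l => expR (l * Y z)) (Y z * expR (x * Y z)).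
  have dm : is_derive x (1 : R) (fun l : R => l * Y z) (Y z).
    have h := is_deriveM (is_derive_id x (1 : R)) (is_derive_cst (Y z) x (1 : R)).
    by apply: (is_derive_eq h); rewrite /cst scaler0 add0r [_ *: _]mulr1.
  have := @is_derive1_comp R expR (fun l => l * Y z) x _ _ (is_derive_expR _) dm.
  by move=> h; apply: (is_derive_eq h); rewrite mulrC.
have := is_derive_bigsum (index_enum T) (mem O) d.
by move=> /(is_deriveZ #|O|%:R^-1).
Qed.

(** Only the quadratic order at 0 matters, and [C] may depend on [Y]: this provides the initial
    condition of Herbst's argument. *)
Lemma ln_mgf_le_sqr Y : avg Y = 0 ->
  exists2 C : R, 0 < C & forall s, 0 < s -> s * C <= 1 -> ln (mgf Y s) <= C * s ^+ 2.
Proof.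
(* The summand 1 gives M <= M^2, so that s C <= 1 implies s M <= 1/2. *)
move=> Y0; pose M : R := 1 + \sum_(z in O) `|Y z|.
have S0 : 0 <= \sum_(z in O) `|Y z| by rewrite sumr_ge0.
have M1 : 1 <= M by rewrite /M; lra.
have YM z : z \in O -> `|Y z| <= M.
  by move=> zO; rewrite /M (bigD1 z)//=; have : 0 <= \sum_(i in O | i != z) `|Y i|
    by [rewrite sumr_ge0]; lra.
have MM : M <= M ^+ 2 by rewrite expr2 ler_peMr//; lra.
exists (2 * M ^+ 2) => [|s s0 sM]; first by lra.
have sM2 : s * M <= 2^-1.
  by have : s * M <= s * M ^+ 2 by [rewrite ler_wpM2l// ltW]; lra.
have : mgf Y s <= 1 + 2 * M ^+ 2 * s ^+ 2.
  have -> : 1 + 2 * M ^+ 2 * s ^+ 2 = avg (fun z => (1 + 2 * M ^+ 2 * s ^+ 2) + s * Y z).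
    by rewrite avgD avg_cst avgZ Y0 mulr0 addr0.
  apply: ler_avg => z /YM hz; set t := s * Y z.
  have tM : `|t| <= s * M by rewrite normrM gtr0_norm// ler_pM2l.
  have [t1 t2] : - (2^-1) <= t /\ t <= 2^-1.
    by apply/andP; rewrite -ler_norml; lra.
  (* For |t| <= 1/2, exp(t) <= 1 / (1 - t) <= 1 + t + 2 t^2. *)
  have e1 : 1 - t <= expR (- t) by exact: expR_ge1Dx.
  have e2 : expR t * (1 - t) <= 1.
    by rewrite -[X in _ <= X](expRxMexpNx_1 t) ler_wpM2l// expR_ge0.
  have tt : t ^+ 2 <= M ^+ 2 * s ^+ 2.
    have sM0 : 0 <= s * M by rewrite mulr_ge0//; lra.
    by rewrite -exprMn [M * s]mulrC -real_normK ?num_real// ler_sqr ?nnegrE.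
  have e3 : 1 <= (1 + 2 * t ^+ 2 + t) * (1 - t).
    have : 0 <= t ^+ 2 * (1 - 2 * t) by rewrite mulr_ge0 ?sqr_ge0//; lra.
    by lra.
  have : expR t <= 1 + 2 * t ^+ 2 + t.
    rewrite -(@ler_pM2r _ (1 - t)); last by lra.
    exact: le_trans e2 e3.
  by lra.
rewrite -(ler_ln (mgf_gt0 _ _)) ?posrE; last first.
  by have : 0 <= M ^+ 2 * s ^+ 2 by [rewrite mulr_ge0 ?sqr_ge0]; lra.
move=> /le_trans; apply; apply: (le_trans (ln_le_subr1 _)).
  by have : 0 <= M ^+ 2 * s ^+ 2 by [rewrite mulr_ge0 ?sqr_ge0]; lra.
by lra.
Qed.

(* Herbst's argument: the hypothesis says that (1/l - a) ln (mgf l) - v l has a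
   nonpositive derivative, and this function tends to 0 as l -> 0+. *)
Lemma herbst Y (a v : R) : 0 < a -> 0 <= v -> avg Y = 0 ->
  (forall l : R, 0 < l -> l * a < 1 ->
    (1 - l * a) * (l * avg (fun z => Y z * expR (l * Y z))) <=
    mgf Y l * (ln (mgf Y l) + v * l ^+ 2)) ->
  forall l : R, 0 < l -> l * a < 1 -> (1 - l * a) * ln (mgf Y l) <= v * l ^+ 2.
Proof.
move=> a0 v0 Y0 H l l0 la.
pose K (l : R) := (l^-1 - a) * ln (mgf Y l) - v * l.
pose dK (l : R) := - l ^- 2 * ln (mgf Y l) +
  (l^-1 - a) * ((mgf Y l)^-1 * avg (fun z => Y z * expR (l * Y z))) - v.
have KD (x : R) : 0 < x -> is_derive x (1 : R) K (dK x).
  move=> x0.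
  have d1 : is_derive x (1 : R) (fun l : R => l^-1) (- x ^- 2).
    have h := @is_deriveV R id x 1 1 (lt0r_neq0 x0) (is_derive_id x (1 : R)).
    by apply: (is_derive_eq h); rewrite [_ *: _]mulr1.
  have d2 : is_derive x (1 : R) (fun l : R => l^-1 - a) (- x ^- 2).
    by have h := is_deriveB d1 (is_derive_cst a x 1); apply: (is_derive_eq h); rewrite subr0.
  have d3 := @is_derive1_comp R (@ln R) (mgf Y) x _ _
    (is_derive1_ln (mgf_gt0 Y x)) (is_derive_mgf Y x).
  have d4 := is_deriveM d2 d3.
  have d5 := is_deriveZ v (is_derive_id x (1 : R)).
  have d6 := is_deriveB d4 d5.
  apply: (is_derive_eq d6); rewrite /dK /= /comp.
  by rewrite /GRing.scale/=; ring.
have dK_le0 (x : R) : 0 < x -> x * a < 1 -> dK x <= 0.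
  move=> x0 xa; have g0 := mgf_gt0 Y x.
  have -> : dK x = ((1 - x * a) * (x * avg (fun z => Y z * expR (x * Y z))) -
      mgf Y x * (ln (mgf Y x) + v * x ^+ 2)) / (x ^+ 2 * mgf Y x).
    by rewrite /dK; field; rewrite !gt_eqF.
  by rewrite mulr_le0_ge0 ?subr_le0 ?H// invr_ge0 mulr_ge0 ?sqr_ge0// ltW.
have Kmono (s : R) : 0 < s -> s <= l -> K l <= K s.
  move=> s0 sl.
  have pos (x : R) : x \in `[s, l] -> 0 < x /\ x * a < 1.
    rewrite in_itv/= => /andP[sx xl]; split; first by lra.
    by apply: le_lt_trans la; rewrite ler_pM2r.
  have sub (x : R) : x \in `]s, l[ -> x \in `[s, l].
    by rewrite !in_itv/= => /andP[/ltW -> /ltW ->].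
  apply: (@ler0_derive1_le_cc _ K s l) => //; last 2 first.
  - by rewrite in_itv/= lexx sl.
  - by rewrite in_itv/= lexx sl.
  - by move=> x /sub/pos[x0 _]; have [] := KD _ x0.
  - move=> x /sub/pos[x0 xa]; rewrite derive1E.
    by have [_ ->] := KD _ x0; exact: dK_le0.
  - apply: derivable_within_continuous => x /pos[x0 _].
    by have [] := KD _ x0.
have KE (s : R) : 0 < s -> s * K s = (1 - s * a) * ln (mgf Y s) - v * s ^+ 2.
  by move=> s0; rewrite /K; field; rewrite gt_eqF.
rewrite -subr_le0 -KE// pmulr_rle0//.
have [C C0 HC] := ln_mgf_le_sqr Y0.
rewrite leNgt; apply/negP => Kl0.
(* A quantitative form of the limit at 0: for this s, monotonicity gives K l <= K s <= C s, while
   the last entry of the minimum gives 2 C s <= K l. *)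
pose s := Num.min l (Num.min C^-1 (K l / (2 * C))).
have s0 : 0 < s by rewrite !lt_min l0 invr_gt0 C0 divr_gt0// mulr_gt0.
have sl : s <= l by rewrite /s ge_min lexx.
have sC : s <= C^-1 by rewrite /s !ge_min lexx orbT.
have sK : s <= K l / (2 * C) by rewrite /s !ge_min lexx !orbT.
have sC1 : s * C <= 1 by rewrite -ler_pdivlMr// mul1r.
have sKC : 2 * (C * s) <= K l by rewrite mulrA [_ * s]mulrC -ler_pdivlMr// mulr_gt0.
have sa : s * a < 1 by apply: le_lt_trans la; rewrite ler_pM2r.
have h1 := HC s s0 sC1; have h2 := Kmono _ s0 sl.
have h3 : s * K s <= s * (C * s).
  rewrite KE//; have : (1 - s * a) * ln (mgf Y s) <= (1 - s * a) * (C * s ^+ 2).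
    by rewrite ler_wpM2l//; lra.
  have : 0 <= s * a * (C * s ^+ 2) by rewrite !mulr_ge0 ?sqr_ge0// ltW.
  have : 0 <= v * s ^+ 2 by rewrite mulr_ge0 ?sqr_ge0.
  by lra.
rewrite ler_pM2l// in h3.
have : 0 < C * s by rewrite mulr_gt0.
by lra.
Qed.

End Averages.

Lemma le_of_eq (d : Order.disp_t) (T : porderType d) (x y : T) : x = y -> (x <= y)%O.
Proof. by move=> ->. Qed.

Section Concentration.
Variables (R : realType) (T : finType) (O : {set T}).
Hypothesis O_neq0 : (0 < #|O|)%N.
Implicit Types (X Y W G : T -> R) (a b l q r v x : R).

Definition entropy G : R :=
  avg O (fun z => G z * ln (G z)) - avg O G * ln (avg O G).

(** The average on the right is the derivative of the [mgf], so an entropy bound is a differential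
    inequality for it. *)
Lemma entropy_expR Y l : entropy (fun z => expR (l * Y z)) =
  l * avg O (fun z => Y z * expR (l * Y z)) - mgf O Y l * ln (mgf O Y l).
Proof.
rewrite /entropy -avgZ; congr (_ - _); apply: eq_avg => z _.
by rewrite expRK; ring.
Qed.

(** The part of the proxy proportional to [W] equals a l^2 times the derivative of the [mgf]; moved
    to the left, it produces the factor 1 - l a. *)
Lemma ln_mgf_self_bounding W r a : 0 < a -> 0 <= r -> avg O W = 0 ->
  (forall l, 0 < l -> entropy (fun z => expR (l * W z)) <=
    l ^+ 2 * (a * avg O (fun z => (r + W z) * expR (l * W z)))) ->
  forall l, 0 < l -> l * a < 1 ->
  (1 - l * a) * ln (mgf O W l) <= a * r * l ^+ 2.
Proof.
move=> a0 r0 W0 H; apply: herbst => //; first by rewrite mulr_ge0// ltW.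
move=> l l0 _; have := H l l0; rewrite entropy_expR.
have -> : avg O (fun z => (r + W z) * expR (l * W z)) =
    r * mgf O W l + avg O (fun z => W z * expR (l * W z)).
  by rewrite -avgZ -avgD; apply: eq_avg => z _; rewrite mulrDl.
by lra.
Qed.

(* The variance proxy [q + W] of [Y] is decoupled from [expR (l * Y)] by the
   Gibbs variational principle, at the price of ln E[expR (W / (2a))] <= r / (2a). *)
Lemma ln_mgf_random_variance Y W q r b a B :
  0 < a -> 0 < b -> 0 < B -> B ^+ 2 = 2 * a * b -> 0 <= r -> 0 <= q ->
  avg O Y = 0 -> avg O W = 0 ->
  (forall l, 0 < l -> entropy (fun z => expR (l * W z)) <=
    l ^+ 2 * (a * avg O (fun z => (r + W z) * expR (l * W z)))) ->
  (forall l, 0 < l -> entropy (fun z => expR (l * Y z)) <=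
    l ^+ 2 * (b * avg O (fun z => (q + W z) * expR (l * Y z)))) ->
  forall l, 0 < l -> l * B < 1 ->
  (1 - l * B) * ln (mgf O Y l) <= b * (q + r) * l ^+ 2.
Proof.
move=> a0 b0 B0 BE r0 q0 Y0 W0 HW HY.
have qr0 : 0 <= b * (q + r) by rewrite mulr_ge0 ?addr_ge0// ltW.
apply: herbst => // l l0 lB.
set G := fun z => expR (l * Y z).
have G0 z : 0 < G z by exact: expR_gt0.
have ent0 : 0 <= entropy G by exact: entropy_ge0.
have mg0 : 0 < mgf O Y l by exact: mgf_gt0.
have lnm : 0 <= ln (mgf O Y l) by apply: ln_ge0; exact: mgf_ge1.
(* Here 1 - t a = 1/2, so the self-bounding estimate reads ln E[exp(t W)] <= 2 a r t^2 = t r. *)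
pose t := (2 * a)^-1.
have t0 : 0 < t by rewrite invr_gt0 mulr_gt0.
have ta : t * a = 2^-1 by rewrite /t; field; rewrite gt_eqF.
have lnW : ln (mgf O W t) <= t * r.
  have := ln_mgf_self_bounding a0 r0 W0 HW t0; rewrite ta => h.
  have -> : t * r = 2 * (a * r * t ^+ 2).
    by rewrite /t; field; rewrite gt_eqF.
  by have := h ltac:(lra); lra.
have WG : avg O (fun z => W z * G z) <= 2 * a * entropy G + mgf O Y l * r.
  have := avg_mul_le_entropy O_neq0 (fun z => t * W z) G0.
  rewrite (eq_avg (Y := fun z => t * (W z * G z))); last by move=> z _; ring.
  rewrite avgZ -/(entropy G) -/(mgf O W t) -/(mgf O Y l) => h.
  have {h} h : t * avg O (fun z => W z * G z) <= entropy G + mgf O Y l * (t * r).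
    by apply: (le_trans h); rewrite lerD2l ler_pM2l.
  rewrite -(ler_pM2l t0); apply: (le_trans h).
  by apply: le_of_eq; rewrite /t; field; rewrite gt_eqF.
have ent_le : entropy G <=
    l ^+ 2 * (b * (q * mgf O Y l + (2 * a * entropy G + mgf O Y l * r))).
  apply: (le_trans (HY l l0)); rewrite ler_pM2l ?exprn_gt0// ler_pM2l//.
  have -> : avg O (fun z => (q + W z) * expR (l * Y z)) =
      q * mgf O Y l + avg O (fun z => W z * G z).
    by rewrite -avgZ -avgD; apply: eq_avg => z _; rewrite mulrDl.
  by rewrite lerD2l.
(* The fed-back entropy is weakened from (l B)^2 to l B, the shape that [herbst] accepts. *)
have lB2 : (l * B) ^+ 2 * entropy G <= l * B * entropy G.
  have lB0 : 0 < l * B by rewrite mulr_gt0.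
  apply: ler_wpM2r; first exact: ent0.
  rewrite expr2. apply: ler_piMl; exact: ltW.
have e2 : l ^+ 2 * (b * (2 * a * entropy G)) = (l * B) ^+ 2 * entropy G.
  by rewrite exprMn BE; ring.
have := entropy_expR Y l; rewrite -/G => entE.
(* In [herbst] the factor 1 - l B also multiplies mgf ln mgf; the extra term has the right sign
   because centering makes the [mgf] at least 1. *)
have : 0 <= l * B * (mgf O Y l * ln (mgf O Y l)).
  by apply: mulr_ge0; apply: mulr_ge0 => //; exact: ltW.
have -> : l * avg O (fun z => Y z * expR (l * Y z)) =
   entropy G + mgf O Y l * ln (mgf O Y l) by rewrite entE; ring.
move: ent_le; rewrite mulrDr mulrDr mulrDr mulrDr e2.
by lra.
Qed.

Lemma chernoff_count Y l t : 0 < l ->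
  #|[set z in O | t < Y z]%SET|%:R <= #|O|%:R * (expR (- (l * t)) * mgf O Y l).
Proof.
move=> l0; rewrite mulrCA /mgf /avg mulVKf ?pnatr_eq0 -?lt0n//.
rewrite mulr_sumr -[_%:R]mulr1 mulr_natl -sumr_const.
rewrite (eq_bigl (fun z => (z \in O) && (t < Y z))); last by move=> z; rewrite inE.
rewrite big_mkcondr; apply: ler_sum => z _; case: ifP => tY.
  by rewrite -expRD -[leLHS]expR0 ler_expR addrC -mulrBr mulr_ge0 ?subr_ge0//; exact: ltW.
by rewrite mulr_ge0// expR_ge0.
Qed.

Lemma bernstein_count Y v b x : 0 < v -> 0 < b -> 0 < x ->
  (forall l, 0 < l -> l * b < 1 -> (1 - l * b) * ln (mgf O Y l) <= v * l ^+ 2) ->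
  #|[set z in O | (2 * Num.sqrt (v * x) + b * x < Y z)%R]%SET|%:R <= #|O|%:R * expR (- x).
Proof.
move=> v0 b0 x0 H.
pose p := Num.sqrt v; pose q := Num.sqrt x.
have p0 : 0 < p by rewrite sqrtr_gt0.
have q0 : 0 < q by rewrite sqrtr_gt0.
have pE : v = p ^+ 2 by rewrite sqr_sqrtr// ltW.
have qE : x = q ^+ 2 by rewrite sqr_sqrtr// ltW.
have pq0 : 0 < p + b * q by rewrite addr_gt0// mulr_gt0.
(* The maximizer of l t - v l^2 / (1 - l b) at the threshold t = 2 sqrt(v x) + b x; the maximum is
   exactly x. *)
pose l := q / (p + b * q).
have l0 : 0 < l by rewrite divr_gt0.
have lb : 1 - l * b = p / (p + b * q) by rewrite /l; field; rewrite gt_eqF.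
have lb0 : 0 < 1 - l * b by rewrite lb divr_gt0.
have sqrtE : Num.sqrt (v * x) = p * q by rewrite sqrtrM// ltW.
have lnm : ln (mgf O Y l) <= l * (p * q).
  rewrite -(ler_pM2l lb0); apply: (le_trans (H l l0 _)); first by lra.
  by apply: le_of_eq; rewrite lb pE /l; field; rewrite gt_eqF.
apply: (le_trans (chernoff_count _ _ l0)); rewrite ler_wpM2l//.
rewrite -[mgf O Y l]lnK ?posrE ?mgf_gt0// -expRD ler_expR sqrtE.
have -> : - x = - (l * (2 * (p * q) + b * x)) + l * (p * q).
  by rewrite qE /l; field; rewrite gt_eqF.
by rewrite lerD2l.
Qed.

End Concentration.

(** * Exchange increments of suprema *)

Section SliceLaplace.
Variables (R : realType) (n u : nat).
Implicit Types (Z : {set 'I_n}) (f V : {set 'I_n} -> R) (i j : 'I_n).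

Lemma slice_setT : slice finset.set0 [set: 'I_n]%SET u = subsets_of_card n u.
Proof. by apply/finset.setP => Z; rewrite !inE finset.sub0set finset.subsetT. Qed.

(** Reversibility of the exchange walk: (Z, i, j) -> (swap i j Z, j, i) is an involution of the
    summation range. *)
Lemma sum_swap_sym (X : {set 'I_n} -> {set 'I_n} -> R) :
  \sum_(Z in subsets_of_card n u) \sum_(i in Z) \sum_(j in (~: Z)%SET) X (swap i j Z) Z =
  \sum_(Z in subsets_of_card n u) \sum_(i in Z) \sum_(j in (~: Z)%SET) X Z (swap i j Z).
Proof.
have E (Y : {set 'I_n} -> {set 'I_n} -> R) :
    \sum_(Z in subsets_of_card n u) \sum_(i in Z) \sum_(j in (~: Z)%SET) Y Z (swap i j Z) =
    \sum_i \sum_j \sum_(Z in subsets_of_card n u | (i \in Z) && (j \notin Z))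
      Y Z (swap i j Z).
  rewrite (exchange_big_dep predT)//=; apply: eq_bigr => i _.
  rewrite (exchange_big_dep predT)//=; apply: eq_bigr => j _.
  by apply: eq_bigl => Z; rewrite !inE; case: (_ == u); case: (i \in Z).
rewrite (E (fun Z Z' => X Z' Z)) (E X) [RHS]exchange_big/=.
apply: eq_bigr => i _; apply: eq_bigr => j _.
rewrite [RHS](reindex_inj (inv_inj (@swapK _ i j)))/=.
have swapC Z : swap j i Z = swap i j Z by rewrite /swap tpermC.
apply: eq_big => [Z|Z _]; last by rewrite swapC swapK.
by rewrite !inE card_swap !mem_swap tpermL tpermR.
Qed.

(** The tangent of exp at the larger exponent bounds the difference of the exponentials. At most one
    positive part is nonzero; keeping both makes the bound symmetric, ready for reversal. *)
Lemma sym_div_expR_le l a b : 0 < l ->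
  sym_div (expR (l * a)) (expR (l * b)) <=
  l ^+ 2 * (Num.max 0 (a - b) ^+ 2 * expR (l * a) + Num.max 0 (b - a) ^+ 2 * expR (l * b)) :> R.
Proof.
have H x y : 0 < l -> y <= x -> sym_div (expR (l * x)) (expR (l * y)) <=
    l ^+ 2 * (Num.max 0 (x - y) ^+ 2 * expR (l * x)
              + Num.max 0 (y - x) ^+ 2 * expR (l * y)).
  move=> l0 yx; rewrite max_r ?subr_ge0// max_l ?subr_le0// expr0n/= mul0r addr0.
  have e : expR (l * x) * (1 + (l * y - l * x)) <= expR (l * y).
    have := expR_ge1Dx (l * y - l * x); rewrite -(ler_pM2l (expR_gt0 (l * x))).
    by rewrite -expRD [l * x + _]addrC subrK.
  have d0 : 0 <= l * (x - y) by rewrite mulr_ge0 ?subr_ge0// ltW.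
  rewrite /sym_div !expRK -mulrBr mulrC.
  have h : l * (x - y) * (expR (l * x) - expR (l * y)) <=
      l * (x - y) * (l * (x - y) * expR (l * x)).
    by rewrite ler_wpM2l//; lra.
  by apply: (le_trans h); lra.
move=> l0; have [ba|/ltW ab] := leP b a; first exact: H.
have := H b a l0 ab; rewrite [X in l ^+ 2 * X]addrC; apply: le_trans.
by rewrite /sym_div -mulrNN !opprB.
Qed.

Hypothesis n_gt0 : (0 < n)%N.
Hypothesis O_neq0 : (0 < #|subsets_of_card n u|)%N.

(** In n / 2, the n comes from the logarithmic Sobolev inequality and the 2 from folding the two
    positive parts into one by reversibility. *)
Lemma entropy_slice_expR f V l : 0 < l ->
  (forall Z, Z \in subsets_of_card n u ->
    \sum_(i in Z) \sum_(j in (~: Z)%SET) Num.max 0 (f Z - f (swap i j Z)) ^+ 2 <=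
    n%:R / 2 * V Z) ->
  entropy (subsets_of_card n u) (fun Z => expR (l * f Z)) <=
  l ^+ 2 * avg (subsets_of_card n u) (fun Z => V Z * expR (l * f Z)).
Proof.
move=> l0 fV; set O := subsets_of_card n u.
have n0 : 0 < n%:R :> R by rewrite ltr0n.
have N0 : 0 < #|O|%:R :> R by rewrite ltr0n.
have := slice_log_sobolev (A := finset.set0) (B := [set: 'I_n]%SET) u
  (F := fun Z => expR (l * f Z)) (fun Z => expR_gt0 _) (finset.sub0set _).
rewrite finset.setD0 cardsT card_ord slice_setT total_ent_avg// -/(entropy _ _) -/O => h.
rewrite -(ler_pM2l N0) -(ler_pM2l n0); apply: (le_trans h).
pose P Z Z' := l ^+ 2 * (Num.max 0 (f Z - f Z') ^+ 2 * expR (l * f Z)).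
apply: (@le_trans _ _ (\sum_(Z in O) \sum_(i in Z) \sum_(j in (~: Z)%SET)
    (P Z (swap i j Z) + P (swap i j Z) Z))).
  rewrite /swap_form slice_setT; apply: ler_sum => Z _.
  rewrite finset.setD0; apply: ler_sum => i _; rewrite finset.setTD.
  by apply: ler_sum => j _; rewrite /P -mulrDr; exact: sym_div_expR_le.
under eq_bigr do under eq_bigr do rewrite big_split/=.
under eq_bigr do rewrite big_split/=.
rewrite big_split/= (sum_swap_sym P).
rewrite [#|O|%:R * _]mulrCA /avg mulVKf ?gt_eqF// !mulr_sumr -big_split/=.
apply: ler_sum => Z /fV hZ.
have -> : \sum_(i in Z) \sum_(j in (~: Z)%SET) P Z (swap i j Z) =
    l ^+ 2 * expR (l * f Z) *
    \sum_(i in Z) \sum_(j in (~: Z)%SET) Num.max 0 (f Z - f (swap i j Z)) ^+ 2.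
  rewrite mulr_sumr; apply: eq_bigr => i _; rewrite mulr_sumr; apply: eq_bigr => j _.
  by rewrite /P; ring.
have c0 : 0 <= l ^+ 2 * expR (l * f Z) by rewrite mulr_ge0 ?sqr_ge0 ?expR_ge0.
have := ler_wpM2l c0 hZ; lra.
Qed.

End SliceLaplace.

(* Near-maximizers replace maximizers, since the supremum need not be attained. *)
Lemma sup_sqr_increment_le (R : realType) (S T : Type) (I : finType) (H : set S)
  (l : S -> T -> R) (z : T) (P : pred I) (z' : I -> T) (M B : R) :
  (H !=set0)%classic -> (forall h w, H h -> `|l h w| <= M) ->
  (forall h, H h -> \sum_(p | P p) Num.max 0 (l h z - l h (z' p)) ^+ 2 <= B) ->
  \sum_(p | P p)
    Num.max 0 (sup [set l h z | h in H]%classic - sup [set l h (z' p) | h in H]%classic) ^+ 2 <= B.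
Proof.
move=> [h0 Hh0] lM lB.
have M0 : 0 <= M by apply: le_trans (lM h0 z Hh0).
have hs w : has_sup [set l h w | h in H]%classic.
  split; first by exists (l h0 w); exists h0.
  by exists M => _ [h Hh <-]; apply: le_trans (lM h w Hh); exact: ler_norm.
(* With y <= 2 M and d <= 1, (y + d)^2 - y^2 <= d (4 M + 1); the final 1 keeps [K] positive when [P]
   is empty. *)
pose K : R := #|P|%:R * (4 * M + 1) + 1.
have K0 : 0 < K by rewrite ltr_wpDl// mulr_ge0//; lra.
apply/ler_addgt0Pr => e e0.
pose d := Num.min 1 (e / K).
have d0 : 0 < d by rewrite lt_min ltr01 divr_gt0.
have d1 : d <= 1 by rewrite ge_min lexx.
have dK : d * K <= e by rewrite -ler_pdivlMr// ge_min lexx orbT.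
(* A single near-maximizer at [z] serves all exchanges at once, so the bound for one h controls the
   whole sum. *)
have [_ [h Hh <-] hd] := sup_adherent d0 (hs z).
apply: (@le_trans _ _ (\sum_(p | P p)
    (Num.max 0 (l h z - l h (z' p)) ^+ 2 + d * (4 * M + 1)))).
  apply: ler_sum => p _; set x := l h z - l h (z' p).
  have xM : x <= 2 * M.
    have := lM h z Hh; have := lM h (z' p) Hh; rewrite !ler_norml /x; lra.
  have sx : sup [set l h z | h in H]%classic - sup [set l h (z' p) | h in H]%classic <= x + d.
    have : l h (z' p) <= sup [set l h (z' p) | h in H]%classic.
      by apply: ub_le_sup; [exact: (hs _).2|exists h].
    by rewrite /x; lra.
  have mx : x <= Num.max 0 x by rewrite le_max lexx orbT.
  have m0 : 0 <= Num.max 0 x by rewrite le_max lexx.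
  have mM : Num.max 0 x <= 2 * M by rewrite ge_max xM andbT; lra.
  apply: (@le_trans _ _ ((Num.max 0 x + d) ^+ 2)).
    rewrite ler_sqr ?nnegrE ?le_max ?lexx//; last by lra.
    by rewrite ge_max; apply/andP; split; lra.
  have : d * (Num.max 0 x) <= d * (2 * M) by rewrite ler_wpM2l// ltW.
  have : d * d <= d * 1 by rewrite ler_wpM2l// ltW.
  by lra.
rewrite big_split/= sumr_const.
have -> : (d * (4 * M + 1)) *+ #|P| = d * K - d by rewrite -[LHS]mulr_natl /K; ring.
by have := lB h Hh; lra.
Qed.

(** * Means over a uniformly random subset and its complement *)

Section Means.
Variables (R : realType) (n : nat).
Implicit Types (h : 'I_n -> R) (Z A : {set 'I_n}) (i j : 'I_n).

Lemma mean_all_sqr h : mean_all (fun i => h i ^+ 2) = second_moment h.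
Proof.
by rewrite /mean_all /mean cardsT card_ord; congr (_ * _); apply: eq_bigl => i; rewrite inE.
Qed.

Lemma card_mulr_mean h A : A != finset.set0 -> #|A|%:R * mean h A = \sum_(i in A) h i.
Proof. by move=> A0; rewrite mulVKf// pnatr_eq0 cards_eq0. Qed.

(** Crude, but it covers empty [A], where the mean is 0; it serves to make the suprema finite. *)
Lemma normr_mean_le h A c : (forall i, `|h i| <= c) -> `|mean h A| <= n%:R * c.
Proof.
move=> hc; rewrite normrM ger0_norm ?invr_ge0//.
have i1 : #|A|%:R^-1 <= 1 :> R.
  by case: #|A| => [|k]; rewrite ?invr0// invf_le1 ?ltr0n// ler1n.
apply: (@le_trans _ _ `|\sum_(i in A) h i|); first by rewrite ler_piMl.
apply: (le_trans (ler_norm_sum _ _ _)); rewrite big_mkcond/=.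
rewrite -[X in X%:R * _](card_ord n) mulr_natl -sumr_const ler_sum// => i _.
by case: ifP => // _; apply: le_trans (hc i).
Qed.

Lemma mean_swap h Z i j : i \in Z -> j \notin Z ->
  mean h (swap i j Z) = mean h Z + #|Z|%:R^-1 * (h j - h i).
Proof.
move=> iZ jZ; rewrite /mean card_swap -mulrDr; congr (_ * _).
have -> : swap i j Z = (j |: (Z :\ i))%SET.
  apply/finset.setP => x; rewrite mem_swap !inE.
  case: tpermP => [->|->|/eqP xi /eqP xj].
  - by rewrite eqxx orbF (negbTE jZ); case: eqVneq => // e; rewrite -e iZ in jZ.
  - by rewrite eqxx iZ.
  - by rewrite (negbTE xi) (negbTE xj).
by rewrite big_setU1 ?inE ?(negbTE jZ) ?andbF//= (big_setD1 i iZ)/=; ring.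
Qed.

Lemma setC_swap Z i j : (~: swap i j Z)%SET = swap j i (~: Z)%SET.
Proof. by apply/finset.setP => x; rewrite !(inE, mem_swap) tpermC. Qed.

End Means.

Section UniformSubset.
Variables (R : realType) (u m : nat).
Hypotheses (u_gt0 : (0 < u)%N) (m_gt0 : (0 < m)%N).
Let O := subsets_of_card (u + m) u.
Implicit Types (h : 'I_(u + m) -> R) (Z : {set 'I_(u + m)}).

Lemma card_subsets_gt0 : (0 < #|O|)%N.
Proof.
have -> : #|O| = 'C(u + m, u) by rewrite -[X in 'C(X, _)]card_ord -card_draws.
by rewrite bin_gt0 leq_addr.
Qed.

Lemma card_subset Z : Z \in O -> #|Z| = u.
Proof. by rewrite inE => /eqP. Qed.

Lemma card_subsetC Z : Z \in O -> #|(~: Z)%SET| = m.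
Proof. by move=> ZO; rewrite cardsCs finset.setCK card_ord card_subset// addKn. Qed.

Lemma subset_neq0 Z : Z \in O -> Z != finset.set0.
Proof. by move=> ZO; rewrite -card_gt0 card_subset. Qed.

Lemma subsetC_neq0 Z : Z \in O -> (~: Z)%SET != finset.set0.
Proof. by move=> ZO; rewrite -card_gt0 card_subsetC. Qed.

Lemma sum_subset_pairs (a b : 'I_(u + m) -> R) Z : Z \in O ->
  \sum_(i in Z) \sum_(j in (~: Z)%SET) (a i + b j) =
  (u * m)%:R * (mean a Z + mean b (~: Z)%SET).
Proof.
move=> ZO.
have Sm (c : R) : \sum_(j in (~: Z)%SET) c = m%:R * c.
  by rewrite sumr_const (card_subsetC ZO) mulr_natl.
have Su (c : R) : \sum_(i in Z) c = u%:R * c.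
  by rewrite sumr_const (card_subset ZO) mulr_natl.
under eq_bigr do rewrite big_split/= Sm.
rewrite big_split/= Su -mulr_sumr -card_mulr_mean ?subset_neq0//.
rewrite -card_mulr_mean ?subsetC_neq0//.
by rewrite card_subset// card_subsetC// natrM; ring.
Qed.

Lemma mean_all_split h Z : Z \in O ->
  (u + m)%:R * mean_all h = u%:R * mean h Z + m%:R * mean h (~: Z)%SET.
Proof.
move=> ZO.
have T0 : [set: 'I_(u + m)]%SET != finset.set0.
  by rewrite -card_gt0 cardsT card_ord addn_gt0 u_gt0.
have := card_mulr_mean h T0; rewrite cardsT card_ord => e.
have := card_mulr_mean h (subset_neq0 ZO); rewrite card_subset// => ->.
have := card_mulr_mean h (subsetC_neq0 ZO); rewrite card_subsetC// => ->.
rewrite [LHS]e (big_setID Z)/= finset.setTI finset.setTD.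
by [].
Qed.

(* Exchanging Z with swap i j Z reverses the sign of [h i - h j], so the sum of
   these differences over all exchanges vanishes. *)
Lemma sum_mean_diff h :
  \sum_(Z in O) (mean h Z - mean h (~: Z)%SET) = 0.
Proof.
pose X Z Z' := \sum_(i in Z) h i - \sum_(i in Z') h i.
have XE Z i j : Z \in O -> i \in Z -> j \in (~: Z)%SET -> X Z (swap i j Z) = h i - h j.
  rewrite [j \in _]inE => ZO iZ jZ; have Zn0 := subset_neq0 ZO.
  have sw0 : swap i j Z != finset.set0 by rewrite -card_gt0 card_swap card_gt0.
  rewrite /X -(card_mulr_mean h Zn0) -(card_mulr_mean h sw0) card_swap mean_swap//.
  by field; rewrite pnatr_eq0 cards_eq0.
have := sum_swap_sym u (fun Z Z' => X Z Z'); rewrite -/O.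
have -> : \sum_(Z in O) \sum_(i in Z) \sum_(j in (~: Z)%SET) X (swap i j Z) Z =
   - \sum_(Z in O) \sum_(i in Z) \sum_(j in (~: Z)%SET) X Z (swap i j Z).
  rewrite -sumrN; apply: eq_bigr => Z _; rewrite -sumrN; apply: eq_bigr => i _.
  by rewrite -sumrN; apply: eq_bigr => j _; rewrite /X opprB.
move=> /eqP; rewrite eq_sym -subr_eq0 opprK -mulr2n mulrn_eq0/= => /eqP S0.
apply: (@mulfI _ (u * m)%:R); first by rewrite pnatr_eq0 -lt0n muln_gt0 u_gt0.
rewrite [RHS]mulr0; apply: (etrans _ S0); rewrite mulr_sumr; apply: eq_bigr => Z ZO.
have := sum_subset_pairs h (fun j => - h j) ZO.
have -> : mean (fun j => - h j) (~: Z)%SET = - mean h (~: Z)%SET.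
  by rewrite /mean sumrN mulrN.
move=> <-; apply: eq_bigr => i iZ; apply: eq_bigr => j jZ.
by rewrite XE.
Qed.

(** The deviation on Z is m / (u + m) times the test-train difference, which averages to 0. *)
Lemma avg_mean_subset h : avg O (fun Z => mean h Z - mean_all h) = 0.
Proof.
have n0 : (u + m)%:R != 0 :> R by rewrite pnatr_eq0 addn_eq0 negb_and -!lt0n u_gt0.
apply: (mulfI n0); rewrite mulr0 -avgZ.
rewrite (eq_avg (Y := fun Z => m%:R * (mean h Z - mean h (~: Z)%SET))).
  by rewrite avgZ /avg sum_mean_diff !mulr0.
by move=> Z ZO; rewrite mulrBr (mean_all_split h ZO) natrD; ring.
Qed.

Lemma avg_mean_subsetC h : avg O (fun Z => mean h (~: Z)%SET - mean_all h) = 0.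
Proof.
have n0 : (u + m)%:R != 0 :> R by rewrite pnatr_eq0 addn_eq0 negb_and -!lt0n u_gt0.
apply: (mulfI n0); rewrite mulr0 -avgZ.
rewrite (eq_avg (Y := fun Z => - u%:R * (mean h Z - mean h (~: Z)%SET))).
  by rewrite avgZ /avg sum_mean_diff !mulr0.
by move=> Z ZO; rewrite mulrBr (mean_all_split h ZO) natrD; ring.
Qed.

End UniformSubset.

(** * Variance proxies of the two suprema *)

Section TestTrain.
Variables (R : realType) (u m : nat) (H : set ('I_(u + m) -> R)) (H0 r : R).
Hypotheses (u_gt0 : (0 < u)%N) (m_gt0 : (0 < m)%N) (H_nonempty : (H !=set0)%classic).
Hypotheses (H0_gt0 : 0 < H0) (r_gt0 : 0 < r).
Hypothesis H_le : forall h, H h -> forall i, `|h i| <= H0.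
Hypothesis H_moment : forall h, H h -> second_moment h <= r.
Let O := subsets_of_card (u + m) u.
Let N : R := (minn u m)%:R.
Implicit Types (h : 'I_(u + m) -> R) (Z : {set 'I_(u + m)}).

(** Ties go to Z, in agreement with [complexity_min]. *)
Definition smaller_side Z := if (u <= m)%N then Z else (~: Z)%SET.

Definition sqr_deviation h Z : R :=
  mean (fun i => h i ^+ 2) (smaller_side Z) - mean_all (fun i => h i ^+ 2).

Definition sqr_deviation_sup Z : R := sup [set sqr_deviation h Z | h in H]%classic.

Lemma minn_gt0R : 0 < N.
Proof. by rewrite ltr0n leq_min u_gt0. Qed.

Lemma sqr_le h : H h -> forall i, `|h i ^+ 2| <= H0 ^+ 2.
Proof.
move=> Hh i; rewrite normrX ler_sqr ?nnegrE ?normr_ge0 ?(ltW H0_gt0)//.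
exact: H_le.
Qed.

Lemma sqr_deviation_bounded h Z : H h ->
  `|sqr_deviation h Z| <= 2 * (u + m)%:R * H0 ^+ 2.
Proof.
move=> Hh; apply: (le_trans (ler_normB _ _)).
have := normr_mean_le (smaller_side Z) (sqr_le Hh).
have := normr_mean_le [set: 'I_(u + m)]%SET (sqr_le Hh).
by rewrite /mean_all; lra.
Qed.

Lemma mean_diff_bounded h Z : H h ->
  `|mean h Z - mean h (~: Z)%SET| <= 2 * (u + m)%:R * H0.
Proof.
move=> Hh; apply: (le_trans (ler_normB _ _)).
have := normr_mean_le Z (H_le Hh).
have := normr_mean_le (~: Z)%SET (H_le Hh).
by lra.
Qed.

Lemma mean_sqr_ge0 h (A : {set 'I_(u + m)}) : 0 <= mean (fun i => h i ^+ 2) A.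
Proof. by rewrite mulr_ge0 ?invr_ge0// sumr_ge0// => i _; exact: sqr_ge0. Qed.

Lemma sqr_deviation_le_sup h Z : H h -> sqr_deviation h Z <= sqr_deviation_sup Z.
Proof.
move=> Hh; apply: ub_le_sup; last by exists h.
exists (2 * (u + m)%:R * H0 ^+ 2) => _ [k Hk <-].
exact: le_trans (ler_norm _) (sqr_deviation_bounded Z Hk).
Qed.

Lemma mean_sqr_smaller_le h Z : H h ->
  mean (fun i => h i ^+ 2) (smaller_side Z) <= r + sqr_deviation_sup Z.
Proof.
move=> Hh; have := sqr_deviation_le_sup Z Hh; have := H_moment Hh.
by rewrite /sqr_deviation mean_all_sqr; lra.
Qed.

(** The squares on this side sum to at most (u + m) r, and it holds at least half of the points. *)
Lemma mean_sqr_larger_le h Z : H h -> Z \in O ->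
  mean (fun i => h i ^+ 2) (~: smaller_side Z)%SET <= 2 * r.
Proof.
move=> Hh ZO; have := H_moment Hh; rewrite -mean_all_sqr => hr.
have n0 : 0 < (u + m)%:R :> R by rewrite ltr0n addn_gt0 u_gt0.
have := ler_wpM2l (ltW n0) hr; rewrite (mean_all_split u_gt0 m_gt0 _ ZO).
set a := mean _ Z; set b := mean _ (~: Z)%SET.
have a0 : 0 <= a by exact: mean_sqr_ge0.
have b0 : 0 <= b by exact: mean_sqr_ge0.
have ua : 0 <= u%:R * a by rewrite mulr_ge0.
have mb : 0 <= m%:R * b by rewrite mulr_ge0.
have uR : 0 < u%:R :> R by rewrite ltr0n.
have mR : 0 < m%:R :> R by rewrite ltr0n.
rewrite natrD mulrDl => le_ab; rewrite /smaller_side; case: leqP => um; rewrite ?finset.setCK.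
  rewrite -/b -(ler_pM2l mR).
  have : u%:R * r <= m%:R * r by rewrite ler_pM2r// ler_nat.
  by lra.
rewrite -/a -(ler_pM2l uR).
have : m%:R * r <= u%:R * r by rewrite ler_pM2r// ler_nat ltnW.
by lra.
Qed.

Lemma mean_sqr_add_le h Z : H h -> Z \in O ->
  mean (fun i => h i ^+ 2) Z + mean (fun i => h i ^+ 2) (~: Z)%SET
    <= 3 * r + sqr_deviation_sup Z.
Proof.
move=> Hh ZO; have := mean_sqr_larger_le Hh ZO; have := mean_sqr_smaller_le Z Hh.
by rewrite /smaller_side; case: leqP => um; rewrite ?finset.setCK; lra.
Qed.

Lemma sup_increment_le (T : Type) (l : T -> {set 'I_(u + m)} -> R) (S : set T) (M B : R) Z :
  (S !=set0)%classic -> (forall k Z, S k -> `|l k Z| <= M) ->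
  (forall k, S k -> \sum_(i in Z) \sum_(j in (~: Z)%SET)
     Num.max 0 (l k Z - l k (swap i j Z)) ^+ 2 <= B) ->
  \sum_(i in Z) \sum_(j in (~: Z)%SET)
    Num.max 0 (sup [set l k Z | k in S]%classic
             - sup [set l k (swap i j Z) | k in S]%classic) ^+ 2 <= B.
Proof.
move=> S0 lM lB; rewrite pair_big_dep/=.
apply: (sup_sqr_increment_le (z' := fun p : 'I_(u + m) * 'I_(u + m) => swap p.1 p.2 Z) S0 lM).
by move=> k Sk; have := lB k Sk; rewrite pair_big_dep.
Qed.

Lemma sqr_max0_le (x y : R) : x <= y -> 0 <= y -> Num.max 0 x ^+ 2 <= y ^+ 2.
Proof.
move=> xy y0; rewrite ler_sqr ?nnegrE// ?le_max ?lexx//.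
by rewrite ge_max y0.
Qed.

(** When k leaves the smaller side, the deviation drops by at most h(k)^2 / N, and the square of
    this is at most H0^2 h(k)^2 / N^2. Summing over k recovers the mean of h^2 on that side, which
    makes the supremum self-bounding. *)
Lemma sqr_deviation_sup_increment Z : Z \in O ->
  \sum_(i in Z) \sum_(j in (~: Z)%SET)
    Num.max 0 (sqr_deviation_sup Z - sqr_deviation_sup (swap i j Z)) ^+ 2 <=
  (u + m)%:R / 2 * (4 * H0 ^+ 2 / N * (r + sqr_deviation_sup Z)).
Proof.
move=> ZO.
apply: (sup_increment_le (M := 2 * (u + m)%:R * H0 ^+ 2)) => // [h Z' Hh|h Hh].
  exact: sqr_deviation_bounded.
have uR : 0 < u%:R :> R by rewrite ltr0n.
have mR : 0 < m%:R :> R by rewrite ltr0n.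
have N0 := minn_gt0R.
pose s := mean (fun i => h i ^+ 2) (smaller_side Z).
have s0 : 0 <= s by exact: mean_sqr_ge0.
have sr : s <= r + sqr_deviation_sup Z by exact: mean_sqr_smaller_le.
have H20 : 0 <= H0 ^+ 2 / N by rewrite mulr_ge0 ?sqr_ge0 ?invr_ge0 ?(ltW N0).
have step (x : R) (k k' : 'I_(u + m)) : x = N^-1 * (h k ^+ 2 - h k' ^+ 2) ->
    Num.max 0 x ^+ 2 <= H0 ^+ 2 / N / N * h k ^+ 2.
  move=> ->; have k0 := sqr_ge0 (h k); have k0' := sqr_ge0 (h k').
  have kH : h k ^+ 2 <= H0 ^+ 2 by apply: le_trans (sqr_le Hh k); exact: ler_norm.
  apply: (le_trans (sqr_max0_le (y := N^-1 * h k ^+ 2) _ _)).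
  - by rewrite ler_pM2l ?invr_gt0//; lra.
  - by rewrite mulr_ge0// invr_ge0 ltW.
  have -> : (N^-1 * h k ^+ 2) ^+ 2 = (N^-1 * N^-1 * h k ^+ 2) * h k ^+ 2 by ring.
  have -> : H0 ^+ 2 / N / N * h k ^+ 2 = (N^-1 * N^-1 * h k ^+ 2) * H0 ^+ 2 by ring.
  have V0 : 0 <= N^-1 by rewrite invr_ge0 ltW.
  by apply: ler_wpM2l => //; apply: mulr_ge0 => //; exact: mulr_ge0.
suff bound : \sum_(i in Z) \sum_(j in (~: Z)%SET)
    Num.max 0 (sqr_deviation h Z - sqr_deviation h (swap i j Z)) ^+ 2 <=
    (u + m)%:R * (H0 ^+ 2 / N * s).
  apply: (le_trans bound).
  have -> : (u + m)%:R / 2 * (4 * H0 ^+ 2 / N * (r + sqr_deviation_sup Z)) =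
    (u + m)%:R * (H0 ^+ 2 / N * (2 * (r + sqr_deviation_sup Z))) by field; rewrite gt_eqF.
  by apply: ler_wpM2l => //; apply: ler_wpM2l => //; lra.
have -> : (u + m)%:R * (H0 ^+ 2 / N * s) =
   u%:R * (H0 ^+ 2 / N * s) + m%:R * (H0 ^+ 2 / N * s) :> R by rewrite natrD; ring.
have us0 : 0 <= u%:R * (H0 ^+ 2 / N * s) by rewrite mulr_ge0// mulr_ge0.
have ms0 : 0 <= m%:R * (H0 ^+ 2 / N * s) by rewrite mulr_ge0// mulr_ge0.
have mean0 (A : {set 'I_(u + m)}) : mean (fun=> 0) A = 0 :> R.
  by rewrite /mean big1 ?mulr0.
have meanZ (c : R) (A : {set 'I_(u + m)}) :
    mean (fun i => c * h i ^+ 2) A = c * mean (fun i => h i ^+ 2) A.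
  by rewrite /mean -mulr_sumr mulrCA.
move: @s step us0 ms0 {s0 sr}; rewrite /N /sqr_deviation /smaller_side.
case: leqP => um step us0 ms0.
  apply: (@le_trans _ _ (\sum_(i in Z) \sum_(j in (~: Z)%SET)
     (H0 ^+ 2 / u%:R / u%:R * h i ^+ 2 + 0))).
    apply: ler_sum => i iZ; apply: ler_sum => j; rewrite inE => jZ; rewrite addr0.
    apply: (step _ i j); rewrite mean_swap// (card_subset ZO); ring.
  rewrite (sum_subset_pairs u_gt0 m_gt0 (fun i => _ * h i ^+ 2) (fun=> 0))// mean0 addr0 meanZ natrM.
  set s := mean _ _ in us0 ms0 *.
  have -> : u%:R * m%:R * (H0 ^+ 2 / u%:R / u%:R * s) =
    m%:R * (H0 ^+ 2 / u%:R * s) by field; rewrite gt_eqF.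
  by lra.
apply: (@le_trans _ _ (\sum_(i in Z) \sum_(j in (~: Z)%SET)
   (0 + H0 ^+ 2 / m%:R / m%:R * h j ^+ 2))).
  apply: ler_sum => i iZ; apply: ler_sum => j jZ; rewrite add0r.
  apply: (step _ j i); rewrite setC_swap mean_swap ?inE ?iZ//.
    by rewrite (card_subsetC ZO); ring.
  by rewrite inE in jZ.
rewrite (sum_subset_pairs u_gt0 m_gt0 (fun=> 0) (fun j => _ * h j ^+ 2))// mean0 add0r meanZ natrM.
set s := mean _ _ in us0 ms0 *.
have -> : u%:R * m%:R * (H0 ^+ 2 / m%:R / m%:R * s) =
  u%:R * (H0 ^+ 2 / m%:R * s) by field; rewrite gt_eqF.
by lra.
Qed.

(** An exchange moves the difference of means by c (h(i) - h(j)) with c = 1/u + 1/m. Since u m c = u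
    + m, the sum of squares is at most 2 (u + m) c times the two means of h^2 together; c <= 2 / N
    then gives the 8. *)
Lemma test_train_sup_increment Z : Z \in O ->
  \sum_(i in Z) \sum_(j in (~: Z)%SET)
    Num.max 0 (test_train_sup H Z - test_train_sup H (swap i j Z)) ^+ 2 <=
  (u + m)%:R / 2 * (8 / N * (3 * r + sqr_deviation_sup Z)).
Proof.
move=> ZO.
apply: (sup_increment_le (M := 2 * (u + m)%:R * H0)
  (l := fun h Z => mean h Z - mean h (~: Z)%SET)) => // [h Z' Hh|h Hh].
  exact: mean_diff_bounded.
have uR : 0 < u%:R :> R by rewrite ltr0n.
have mR : 0 < m%:R :> R by rewrite ltr0n.
have N0 := minn_gt0R.
pose c : R := u%:R^-1 + m%:R^-1.
have c0 : 0 < c by rewrite addr_gt0 ?invr_gt0.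
have cN : c <= 2 / N.
  have Nu : u%:R^-1 <= N^-1 by rewrite lef_pV2 ?posrE// ler_nat geq_minl.
  have Nm : m%:R^-1 <= N^-1 by rewrite lef_pV2 ?posrE// ler_nat geq_minr.
  by rewrite /c; lra.
set sa := 3 * r + _.
have := mean_sqr_add_le Hh ZO; rewrite -/sa; set s := _ + _ => ssa.
have s0 : 0 <= s by rewrite addr_ge0 ?mean_sqr_ge0.
apply: (@le_trans _ _ (\sum_(i in Z) \sum_(j in (~: Z)%SET)
   (2 * c ^+ 2 * h i ^+ 2 + 2 * c ^+ 2 * h j ^+ 2))).
  apply: ler_sum => i iZ; apply: ler_sum => j; rewrite inE => jZ.
  rewrite setC_swap !mean_swap ?inE ?iZ ?jZ// (card_subset ZO) (card_subsetC ZO).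
  set x := _ - _; have -> : x = c * (h i - h j) by rewrite /x /c; ring.
  apply: (@le_trans _ _ ((c * (h i - h j)) ^+ 2)).
    rewrite -(real_normK (num_real (c * (h i - h j)))).
    by apply: sqr_max0_le; rewrite ?ler_norm.
  have : 0 <= c ^+ 2 * (h i + h j) ^+ 2 by rewrite mulr_ge0 ?sqr_ge0.
  by lra.
rewrite (sum_subset_pairs u_gt0 m_gt0 (fun i => _ * h i ^+ 2) (fun i => _ * h i ^+ 2))//.
have meanZ (d : R) (A : {set 'I_(u + m)}) :
    mean (fun i => d * h i ^+ 2) A = d * mean (fun i => h i ^+ 2) A.
  by rewrite /mean -mulr_sumr mulrCA.
rewrite !meanZ -mulrDr -/s.
have -> : (u * m)%:R * (2 * c ^+ 2 * s) = (u + m)%:R * (c * (2 * s)).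
  by rewrite natrM natrD /c; field; rewrite !gt_eqF.
have -> : (u + m)%:R / 2 * (8 / N * sa) = (u + m)%:R * (2 / N * (2 * sa)) by field; rewrite gt_eqF.
by rewrite ler_wpM2l// ler_pM//; [exact: ltW|lra|lra].
Qed.

End TestTrain.

(** * Complexities, probabilities and numerical constants *)

Lemma normr_le_max_abs (R : realType) (n : nat) (h : 'I_n -> R) i :
  `|h i| <= max_abs h.
Proof. exact: (le_bigmax_cond (P := predT) 0 (fun i => `|h i|)). Qed.

Lemma complexity_min_sqr (R : realType) (u m : nat) (H : set ('I_(u + m) -> R)) :
  complexity_min (sqr_class H) =
  avg (subsets_of_card (u + m) u) (sqr_deviation_sup H).
Proof.
rewrite /complexity_min /complexity_test /complexity_train /unif_exp /avg.
rewrite /sqr_deviation_sup /sqr_deviation /smaller_side /sqr_class.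
by case: leqP => um; congr (_ * _); apply: eq_bigr => Z _; rewrite image_comp.
Qed.

(** The supremum dominates the deviation of any fixed member, which averages to 0. *)
Lemma avg_sqr_deviation_sup_ge0 (R : realType) (u m : nat)
  (H : set ('I_(u + m) -> R)) (H0 : R) : (0 < u)%N -> (0 < m)%N ->
  (H !=set0)%classic -> 0 < H0 -> (forall h, H h -> forall i, `|h i| <= H0) ->
  0 <= avg (subsets_of_card (u + m) u) (sqr_deviation_sup H).
Proof.
move=> u0 m0 [h Hh] H00 HH.
apply: (@le_trans _ _ (avg (subsets_of_card (u + m) u) (sqr_deviation h))).
  rewrite /sqr_deviation /smaller_side; case: leqP => _.
    by rewrite avg_mean_subset.
  by rewrite avg_mean_subsetC.
by apply: ler_avg => Z _; apply: (sqr_deviation_le_sup _ HH).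
Qed.

Lemma unif_prob_ge (R : realType) (n u : nat) (P : pred {set 'I_n}) (e : R) :
  (0 < #|subsets_of_card n u|)%N ->
  #|[set Z in subsets_of_card n u | ~~ P Z]%SET|%:R <=
    #|subsets_of_card n u|%:R * e ->
  1 - e <= unif_prob R u P.
Proof.
move=> O0; set O := subsets_of_card n u => bad.
have N0 : 0 < #|O|%:R :> R by rewrite ltr0n.
have : #|O|%:R = #|[set Z in O | P Z]%SET|%:R + #|[set Z in O | ~~ P Z]%SET|%:R :> R.
  rewrite -natrD; congr _%:R; rewrite -(cardsID [set Z | P Z]%SET O); congr (_ + _)%N.
    by apply: eq_card => Z; rewrite !inE.
  by apply: eq_card => Z; rewrite !inE andbC.
rewrite /unif_prob -/O ler_pdivlMr//; lra.
Qed.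

Lemma bernstein_threshold_le (R : realType) (r rho x N H0 : R) :
  0 < r -> 0 <= rho -> 0 < N -> 0 < x -> 0 < H0 ->
  2 * Num.sqrt (8 / N * ((3 * r + rho) + (r + rho)) * x) + 8 * H0 / N * x <=
  Num.sqrt 219 * Num.sqrt (r * x / N) + Num.sqrt 219 / 2 * rho
    + (16 * H0 + Num.sqrt 219 / 2) * x / N.
Proof.
move=> r0 rho0 N0 x0 H00; set c := Num.sqrt 219.
(* 144 <= 219; the comparison sees [c] through this bound. *)
have c12 : 12 <= c.
  have -> : 12 = Num.sqrt (12 ^+ 2) :> R by rewrite sqrtr_sqr ger0_norm//; lra.
  by rewrite /c ler_sqrt; lra.
set p := Num.sqrt (r * x / N); pose t := x / N.
have t0 : 0 < t by rewrite divr_gt0.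
have p0 : 0 <= p by exact: sqrtr_ge0.
have pE : p ^+ 2 = r * t by rewrite sqr_sqrtr ?mulrA// !mulr_ge0 ?invr_ge0// ltW.
(* On squaring, 36 p^2 covers 32 r t and 4 (rho + t)^2 covers 16 rho t. Doubling the right side
   gives the 12 in front of [p]. *)
have s1 : Num.sqrt (8 / N * ((3 * r + rho) + (r + rho)) * x) <= 6 * p + 2 * (rho + t).
  have b0 : 0 <= 6 * p + 2 * (rho + t) by lra.
  rewrite -[leRHS](ger0_norm b0) -sqrtr_sqr ler_wsqrtr//.
  have -> : 8 / N * ((3 * r + rho) + (r + rho)) * x = 32 * (r * t) + 16 * (rho * t).
    by rewrite /t; ring.
  rewrite -pE.
  have : 0 <= p * (rho + t) by rewrite mulr_ge0//; lra.
  have := sqr_ge0 (rho - t); have := sqr_ge0 p; lra.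
have -> : (16 * H0 + c / 2) * x / N = (16 * H0 + c / 2) * t by rewrite mulrA.
have -> : 8 * H0 / N * x = 8 * (H0 * t) by rewrite /t; ring.
have : 0 <= H0 * t by rewrite mulr_ge0// ltW.
have : 12 * p <= c * p by rewrite ler_wpM2r.
have : 12 * rho <= c * rho by rewrite ler_wpM2r.
have : 12 * t <= c * t by rewrite ler_wpM2r// ltW.
by lra.
Qed.

Local Open Scope classical_set_scope.

Theorem mainTheorem1 (R : realType) (u m : nat) (hu : (2 <= u)%N)
  (hm : (2 <= m)%N) (H : set ('I_(u + m) -> R)) (H_nonempty : H !=set0)
  (H0 r : R) (H0_gt0 : 0 < H0) (r_gt0 : 0 < r)
  (H_bounded : (ereal_sup [set (max_abs h)%:E | h in H] <= H0%:E)%E)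
  (H_moment : (ereal_sup [set (second_moment h)%:E | h in H] <= r%:E)%E)
  (x : R) (x_gt0 : 0 < x) :
  let c0 : R := Num.sqrt 219 in
  let N : R := (minn u m)%:R in
  1 - expR (- x) <=
  unif_prob R u (fun Z : {set 'I_(u + m)} =>
    test_train_sup H Z <=
      unif_exp u (test_train_sup H)
      + c0 * Num.sqrt (r * x / N)
      + c0 / 2 * complexity_min (sqr_class H)
      + (16 * H0 + c0 / 2) * x / N).
Proof.
lazy zeta; set c0 : R := Num.sqrt 219; set N : R := (minn u m)%:R.
have u0 : (0 < u)%N by exact: leq_trans hu.
have m0 : (0 < m)%N by exact: leq_trans hm.
have HH h : H h -> forall i, `|h i| <= H0.
  move=> Hh i; apply: (le_trans (normr_le_max_abs h i)); rewrite -lee_fin.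
  by apply: le_trans H_bounded; apply: ereal_sup_ubound; exists h.
have Hr h : H h -> second_moment h <= r.
  move=> Hh; rewrite -lee_fin.
  by apply: le_trans H_moment; apply: ereal_sup_ubound; exists h.
have N0 : 0 < N by exact: minn_gt0R.
have O0 := card_subsets_gt0 u m; have n0 : (0 < u + m)%N by rewrite addn_gt0 u0.
set O := subsets_of_card (u + m) u in O0.
have rho0 := avg_sqr_deviation_sup_ge0 u0 m0 H_nonempty H0_gt0 HH.
rewrite complexity_min_sqr; set rho := avg _ _ in rho0 *.
rewrite -[unif_exp u _]/(avg O (test_train_sup H)); set Eg := avg _ _.
(* Centering leaves the increments unchanged and moves [rho], the complexity of the squared class,
   into the proxies: r becomes r + rho, and 3 r becomes 3 r + rho. *)
pose Y Z := test_train_sup H Z - Eg; pose W Z := sqr_deviation_sup H Z - rho.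
have centered (f : {set 'I_(u + m)} -> R) :
    avg O (fun Z => f Z - avg O f) = 0.
  by rewrite avgD avg_cst// subrr.
(* These are the [a], [b] and [B] of [ln_mgf_random_variance]; [B] becomes the coefficient of x in
   the deviation. *)
have a0 : 0 < 4 * H0 ^+ 2 / N by rewrite divr_gt0// mulr_gt0// exprn_gt0.
have b0 : 0 < 8 / N by rewrite divr_gt0.
have B0 : 0 < 8 * H0 / N by rewrite divr_gt0// mulr_gt0.
(* The increment bound for W has the constant 4 so that this is a perfect square. *)
have BE : (8 * H0 / N) ^+ 2 = 2 * (4 * H0 ^+ 2 / N) * (8 / N) by field; rewrite gt_eqF.
have entW l : 0 < l -> entropy O (fun Z => expR (l * W Z)) <=
    l ^+ 2 * (4 * H0 ^+ 2 / N * avg O (fun Z => (r + rho + W Z) * expR (l * W Z))).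
  move=> l0; rewrite -avgZ.
  rewrite [X in _ * X](eq_avg (Y := fun Z =>
      4 * H0 ^+ 2 / N * (r + sqr_deviation_sup H Z) * expR (l * W Z))).
    apply: entropy_slice_expR => // Z ZO.
    under eq_bigr do under eq_bigr do rewrite /W opprB addrA subrK.
    exact: sqr_deviation_sup_increment.
  by move=> Z _; rewrite mulrA /W -addrA [rho + _]addrC subrK.
have entY l : 0 < l -> entropy O (fun Z => expR (l * Y Z)) <=
    l ^+ 2 * (8 / N * avg O (fun Z => (3 * r + rho + W Z) * expR (l * Y Z))).
  move=> l0; rewrite -avgZ.
  rewrite [X in _ * X](eq_avg (Y := fun Z =>
      8 / N * (3 * r + sqr_deviation_sup H Z) * expR (l * Y Z))).
    apply: entropy_slice_expR => // Z ZO.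
    under eq_bigr do under eq_bigr do rewrite /Y opprB addrA subrK.
    exact: (test_train_sup_increment (H0 := H0)).
  by move=> Z _; rewrite mulrA /W -addrA [rho + _]addrC subrK.
have q0 : 0 <= 3 * r + rho by lra.
have s0 : 0 <= r + rho by lra.
have mgfY := ln_mgf_random_variance O0 a0 b0 B0 BE s0 q0
  (centered (test_train_sup H)) (centered (sqr_deviation_sup H)) entW entY.
have v0 : 0 < 8 / N * (3 * r + rho + (r + rho)) by rewrite mulr_gt0//; lra.
apply: unif_prob_ge => //; apply: le_trans (bernstein_count O0 v0 B0 x_gt0 mgfY).
rewrite ler_nat; apply/subset_leq_card/fintype.subsetP => Z; rewrite !inE -ltNge.
move=> /andP[-> /=] g_gt; rewrite /Y ltrBrDr; apply: le_lt_trans g_gt.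
have := bernstein_threshold_le r_gt0 rho0 N0 x_gt0 H0_gt0; rewrite -/c0 -/Eg.
by lra.
Qed.
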